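(* Let $\aleph_2\le\kappa\le\lambda$ be regular cardinals with $\alpha^{\omega}<\kappa$ for all $\alpha<\kappa$. Then: $\mathrm{SSR}([2^{\lambda^{<\kappa}}]^{\omega},{<}\kappa)$ implies that $\mathrm{Nm}(\kappa,\lambda,I)$ is semiproper for every fine ideal $I$ on $\mathcal{P}_\kappa\lambda$; this in turn implies that $\mathrm{Nm}(\kappa,\lambda)$ is semiproper; and this in turn implies $\mathrm{SSR}([\lambda]^{\omega},{<}\kappa)$.
   Context: $S\subseteq[W]^\omega$ is semistationary if $\{x\in[W]^\omega:\exists y\in S\,(y\subseteq x, y\cap\omega_1=x\cap\omega_1)\}$ is stationary. $\mathcal{P}_\kappa X=\{a\subseteq X:|a|<\kappa\}$. $\mathrm{SSR}([W]^\omega,{<}\kappa)$: every semistationary $S\subseteq[W]^\omega$ has $R\in\mathcal{P}_\kappa W$ with $\omega_1\subseteq R$, $R\cap\kappa\in\kappa$ and $S\cap[R]^\omega$ semistationary. A poset is semiproper if for large regular $\theta$ the set of countable $M\subseteq\mathcal{H}_\theta$ such that each $p\in M\cap P$ has $q\le p$ forcing $M[\dot G]\cap\omega_1=M\cap\omega_1$ contains a club. An ideal $I$ on $\mathcal{P}_\kappa\lambda$ is fine if $\{a:\xi\notin a\}\in I$ for each $\xi<\lambda$; $I^+$ is its complement. $\mathrm{Nm}(\kappa,\lambda,I)$: the set, ordered by inclusion, of trees $p$ of finite $\subseteq$-increasing sequences of elements of $\mathcal{P}_\kappa\lambda$, closed under initial segments, with a trunk (longest node comparable with all nodes), such that each node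 $s$ extending the trunk has $\{x:s^\frown\langle x\rangle\in p\}\in I^+$. $\mathrm{Nm}(\kappa,\lambda)=\mathrm{Nm}(\kappa,\lambda,J^{bd}_{\kappa\lambda})$ where $J^{bd}_{\kappa\lambda}$ is the ideal of $A$ such that some $b\in\mathcal{P}_\kappa\lambda$ has $b\not\subseteq a$ for all $a\in A$.
   Formalization: ''Ideal on P_κλ'' is taken to mean a proper, κ-complete ideal; for merely finitely additive fine ideals the first implication can fail (e.g. κ supercompact and the ideal generated by the sets {a : ξ∉a}, where the forcing makes ω_1 have cofinality ω). *)

(* Defs.v *)
From HB Require Import structures.
From mathcomp Require Import all_boot.
From mathcomp Require Import generic_quotient.
From mathcomp Require Import mathcomp_extra boolp classical_sets functions.
From mathcomp Require Import cardinality.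

Set Implicit Arguments.
Unset Strict Implicit.
Unset Printing Implicit Defensive.

Local Open Scope classical_set_scope.
Local Open Scope card_scope.
Local Open Scope quotient_scope.

(* The universe of sets is Aczel's type of well-founded trees modulo
   extensional equality.  [V] satisfies (second-order) ZFC: extensionality,
   separation, pairing, union, replacement, power set, infinity and foundation
   are proved below, and choice comes from the metatheory. *)

Inductive tree : Type := Sup (A : Type) (f : A -> tree).

Fixpoint eqtree (x y : tree) {struct x} : Prop :=
  match x, y with
  | Sup A f, Sup B g =>
      (forall a, exists b, eqtree (f a) (g b)) /\
      (forall b, exists a, eqtree (f a) (g b))
  end.

Lemma eqtree_refl x : eqtree x x.
Proof. by elim: x => A f IH; split=> a; exists a. Qed.

Lemma eqtree_sym x y : eqtree x y -> eqtree y x.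
Proof.
elim: x y => A f IH [B g] [h1 h2]; split=> [b|a].
- by have [a /IH ?] := h2 b; exists a.
- by have [b /IH ?] := h1 a; exists b.
Qed.

Lemma eqtree_trans x y z : eqtree x y -> eqtree y z -> eqtree x z.
Proof.
elim: x y z => A f IH [B g] [C h] [p1 p2] [q1 q2]; split=> [a|c].
- by have [b /IH xy] := p1 a; have [c /xy ?] := q1 b; exists c.
- by have [b yz] := q2 c; have [a /IH xy] := p2 b; exists a; exact: xy yz.
Qed.

HB.instance Definition _ := gen_eqMixin tree.
HB.instance Definition _ := gen_choiceMixin tree.

Definition eqtreeb : rel tree := fun x y => `[< eqtree x y >].

Lemma eqtreeb_refl : reflexive eqtreeb.
Proof. by move=> x; apply/asboolP/eqtree_refl. Qed.
Lemma eqtreeb_sym : symmetric eqtreeb.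
Proof. by move=> x y; apply: asbool_equiv_eq; split; apply: eqtree_sym. Qed.
Lemma eqtreeb_trans : transitive eqtreeb.
Proof.
move=> y x z /asboolP xy /asboolP yz; apply/asboolP; exact: eqtree_trans yz.
Qed.

Canonical eqtree_equiv := EquivRel eqtreeb eqtreeb_refl eqtreeb_sym eqtreeb_trans.

Definition V : Type := {eq_quot eqtree_equiv}.

Definition subtrees (t : tree) : set tree := let: Sup A f := t in range f.

Definition elts (y : V) : set V := \pi_V @` subtrees (repr y).

Notation "x ∈ y" := (elts y x) (at level 70, no associativity).
Notation "x ⊆ y" := (elts x `<=` elts y) (at level 70, no associativity).

Definition vempty : V := \pi_V (Sup (False_rect tree)).

Definition small (A : set V) : Prop := exists x : V, elts x = A.

(* The set with the same elements as the class [A]; junk ([vempty]) if [A] is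
   a proper class. *)
Definition vset (A : set V) : V := xget vempty [set x | elts x = A].

Lemma vsetK A : small A -> elts (vset A) = A.
Proof. by rewrite /vset => sA; case: xgetP => // /forallNP. Qed.

Lemma pi_eqtree (t u : tree) : \pi_V t = \pi_V u <-> eqtree t u.
Proof. by split=> [/eqquotP/asboolP|?]; last by apply/eqquotP/asboolP. Qed.

Lemma elts_pi (A : Type) (f : A -> tree) : elts (\pi_V (Sup f)) = range (\pi_V \o f).
Proof.
have : eqtree (repr (\pi_V (Sup f))) (Sup f) by apply/pi_eqtree; rewrite reprK.
rewrite /elts; case: (repr _) => B g [h1 h2]; apply/seteqP; split=> x.
- move=> [_ [b _ <-] <-]; have [a ?] := h1 b; exists a => //=.
  exact/pi_eqtree/eqtree_sym.
- move=> [a _ <-]; have [b ?] := h2 a; exists (g b); first by exists b.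
  exact/pi_eqtree.
Qed.

Lemma small_range (A : Type) (f : A -> tree) (g : A -> V) :
  (forall a, \pi_V (f a) = g a) -> small (range g).
Proof.
by move=> fg; exists (\pi_V (Sup f)); rewrite elts_pi; congr (_ @` _); apply/funext.
Qed.

Lemma elts_range (x : V) : exists (A : Type) (f : A -> tree),
  x = \pi_V (Sup f) /\ elts x = range (\pi_V \o f).
Proof.
case E: (repr x) => [A f]; exists A, f.
have xE : x = \pi_V (Sup f) by rewrite -E reprK.
by split=> //; rewrite {1}xE elts_pi.
Qed.

Lemma extensionality : injective elts.
Proof.
move=> x y; have [A [f [-> ->]]] := elts_range x.
have [B [g [-> ->]]] := elts_range y => /seteqP[h1 h2].
apply/pi_eqtree; split=> [a|b].
- by have [|b _ /pi_eqtree/eqtree_sym ?] := h1 (\pi_V (f a)); [exists a|exists b].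
- by have [|a _ /pi_eqtree ?] := h2 (\pi_V (g b)); [exists b|exists a].
Qed.

Lemma foundation (P : V -> Prop) :
  (forall x, (forall y, y ∈ x -> P y) -> P x) -> forall x, P x.
Proof.
move=> IH x; rewrite -[x]reprK; elim: (repr x) => A f IHf.
by apply: IH => y; rewrite elts_pi => -[a _ <-]; exact: IHf.
Qed.

Lemma separation (x : V) (A : set V) : A `<=` elts x -> small A.
Proof.
have [B [f [_ ->]]] := elts_range x => sA.
suff -> : A = range (fun b : {b : B | A (\pi_V (f b))} => \pi_V (f (sval b))).
  exact: small_range.
apply/seteqP; split=> [y Ay|_ [[b Ab] _ <-]] //.
have [b _ yE] := sA _ Ay; rewrite /= in yE.
have Ab : A (\pi_V (f b)) by rewrite yE.
by exists (exist _ b Ab).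
Qed.

Lemma replacement (x : V) (F : V -> V) : small (F @` elts x).
Proof.
have [B [f [_ ->]]] := elts_range x.
suff -> : F @` range (\pi_V \o f) = range (fun b => F (\pi_V (f b))).
  by apply: (@small_range _ (fun b => repr (F (\pi_V (f b))))) => b; rewrite reprK.
by rewrite image_comp.
Qed.

Lemma union (x : V) : small (\bigcup_(y in elts x) elts y).
Proof.
have [B [f [_ ->]]] := elts_range x.
pose I b := let: Sup A _ := f b in A.
pose h (p : {b : B & I b}) : tree :=
  (match f (projT1 p) as t return (let: Sup A _ := t in A) -> tree with
   | Sup A g => g end) (projT2 p).
suff -> : \bigcup_(y in range (\pi_V \o f)) elts y = range (\pi_V \o h).
  exact: (@small_range _ h).
have hE b : elts (\pi_V (f b)) = range (fun i : I b => \pi_V (h (existT _ b i))).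
  by rewrite /h /I /=; case: (f b) => A g; rewrite elts_pi.
apply/seteqP; split=> [y [_ [b _ <-]] /=|_ [[b i] _ <-]].
  by rewrite hE => -[i _ <-]; exists (existT _ b i).
by exists (\pi_V (f b)); [exists b|rewrite hE; exists i].
Qed.

Lemma powerset (x : V) : small [set y | y ⊆ x].
Proof.
have [B [f [_ fE]]] := elts_range x.
pose h (A : B -> Prop) := Sup (fun b : {b : B | A b} => f (sval b)).
suff -> : [set y | y ⊆ x] = range (\pi_V \o h) by exact: (@small_range _ h).
rewrite fE; apply/seteqP; split=> [y /= yx|_ [A _ <-] /=].
  exists (fun b => \pi_V (f b) ∈ y) => //=; apply: extensionality.
  rewrite elts_pi; apply/seteqP; split=> [_ [[b ?] _ <-] //|z zy].
  have [b _ zE] := yx _ zy; rewrite /= in zE.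
  have by_ : \pi_V (f b) ∈ y by rewrite zE.
  by exists (exist _ b by_).
by rewrite elts_pi => _ [[b ?] _ <-]; exists b.
Qed.

Lemma infinity (f : nat -> V) : small (range f).
Proof. by apply: (@small_range _ (repr \o f)) => n /=; rewrite reprK. Qed.

Lemma pairing (x y : V) : small [set x; y].
Proof.
suff -> : [set x; y] = range (fun b : bool => if b then x else y).
  by apply: (@small_range _ (fun b => repr (if b then x else y))) => b; rewrite reprK.
by apply/seteqP; split=> [_ [->|->]|_ [[] _ <-]]; [exists true|exists false|left|right].
Qed.

Definition kpair (x y : V) : V := vset [set vset [set x; x]; vset [set x; y]].

Definition succ (x : V) : V := vset (elts x `|` [set x]).
Definition num (n : nat) : V := iter n succ vempty.

Definition transitive_set (x : V) : Prop := forall y, y ∈ x -> y ⊆ x.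
Definition ordinal (x : V) : Prop :=
  transitive_set x /\ forall y, y ∈ x -> transitive_set y.
Definition cardinal (k : V) : Prop :=
  ordinal k /\ forall a, a ∈ k -> ~~ (elts k #<= elts a).
Definition regular (k : V) : Prop :=
  [/\ cardinal k, infinite_set (elts k)
    & forall (a : V) (f : V -> V), a ∈ k -> (forall x, x ∈ a -> f x ∈ k) ->
      exists2 b, b ∈ k & forall x, x ∈ a -> f x ∈ b].

Definition cardV (A : set V) : V := xget vempty [set k | cardinal k /\ elts k #= A].

Definition next_cardinal (k : V) : V :=
  xget vempty [set l | [/\ cardinal l, k ∈ l &
                       forall m, cardinal m -> k ∈ m -> l ⊆ m]].

Definition omega : V := vset (range num).
Definition omega1 : V := next_cardinal omega.
Definition omega2 : V := next_cardinal omega1.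

Definition funs (A B : set V) : set V :=
  [set f | (forall e, e ∈ f -> exists a b, [/\ A a, B b & e = kpair a b]) /\
           (forall a, A a -> exists! b, kpair a b ∈ f)].

Definition cexp (a b : V) : V := cardV (funs (elts b) (elts a)).
Definition cexp_lt (a b : V) : V :=
  cardV (\bigcup_(c in elts b) funs (elts c) (elts a)).

Definition Pk (k X : V) : set V := [set a | a ⊆ X /\ ~~ (elts k #<= elts a)].

Definition ctbl_subsets (W : set V) : set (set V) :=
  [set x | x `<=` W /\ x #= [set: nat]].

Definition club (W : set V) (C : set (set V)) : Prop :=
  [/\ C `<=` ctbl_subsets W,
      forall x, ctbl_subsets W x -> exists2 y, C y & x `<=` y
    & forall u : nat -> set V, (forall n, C (u n)) ->
        (forall n, u n `<=` u n.+1) -> C (\bigcup_n u n)].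

Definition stationary (W : set V) (S : set (set V)) : Prop :=
  S `<=` ctbl_subsets W /\ forall C, club W C -> S `&` C !=set0.

Definition semistationary (W : set V) (S : set (set V)) : Prop :=
  S `<=` ctbl_subsets W /\
  stationary W [set x | ctbl_subsets W x /\
    exists y, [/\ S y, y `<=` x & y `&` elts omega1 = x `&` elts omega1]].

Definition SSR (W k : V) : Prop :=
  forall S, semistationary (elts W) S ->
  exists R, [/\ Pk k W R, omega1 ⊆ R,
                exists2 d, d ∈ k & elts R `&` elts k = elts d
              & semistationary (elts R) (S `&` ctbl_subsets (elts R))].

Inductive trcl (x : V) : set V :=
| trcl_elt y : y ∈ x -> trcl x y
| trcl_step y z : trcl x y -> z ∈ y -> trcl x z.

Definition Hset (theta : V) : set V := [set x | ~~ (elts theta #<= trcl x)].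

Section Forcing.
Variables (P : set V) (le : V -> V -> Prop).

Inductive name : set V :=
| Name x : (forall e, e ∈ x -> exists y p, [/\ name y, P p & e = kpair y p]) ->
  name x.

(* A poset need not have a greatest element, so every condition is attached to
   each element of a canonical name. *)
Fixpoint check_tree (t : tree) : V :=
  let: Sup A f := t in
  vset [set e | exists a p, P p /\ e = kpair (check_tree (f a)) p].
Definition check (x : V) : V := check_tree (repr x).

(* The usual recursion defining [p ⊩ x = y]: each member of [x] below [p] is
   densely forced to be a member of [y], and conversely.  The recursion is
   well-founded, so the least fixpoint is the only one. *)
Inductive forces_eq : V -> V -> V -> Prop :=
| ForcesEq p x y :
    (forall z s q, kpair z s ∈ x -> P q -> le q p -> le q s ->
       exists r w t, [/\ P r, le r q, kpair w t ∈ y, le r t & forces_eq r z w]) ->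
    (forall w t q, kpair w t ∈ y -> P q -> le q p -> le q t ->
       exists r z s, [/\ P r, le r q, kpair z s ∈ x, le r s & forces_eq r z w]) ->
    forces_eq p x y.

(* A sentence of the forcing language is represented by the set of conditions
   forcing it. *)
Definition f_in (x y : V) : set V :=
  [set p | forall q, P q -> le q p ->
    exists r z s, [/\ P r, le r q, kpair z s ∈ y, le r s & forces_eq r x z]].
Definition f_not (phi : set V) : set V :=
  [set p | forall q, P q -> le q p -> ~ phi q].
Definition f_and (phi psi : set V) : set V := phi `&` psi.
Definition f_imp (phi psi : set V) : set V := f_not (f_and phi (f_not psi)).
Definition f_iff (phi psi : set V) : set V := f_and (f_imp phi psi) (f_imp psi phi).
Definition f_all (phi : V -> set V) : set V :=
  [set p | forall x, name x -> phi x p].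

(* A name for M[G] = {t^G : t in M a P-name}. *)
Definition ext_name (M : set V) : V :=
  vset [set e | exists t p, [/\ M t, name t, P p & e = kpair t p]].

Definition forces_same_omega1 (M : set V) (q : V) : Prop :=
  f_all (fun x =>
    f_iff (f_and (f_in x (ext_name M)) (f_in x (check omega1)))
          (f_in x (check (vset (M `&` elts omega1))))) q.

Definition semiproper : Prop :=
  exists2 theta0, ordinal theta0 &
  forall theta, regular theta -> theta0 ∈ theta ->
  exists2 C, club (Hset theta) C &
    C `<=` [set M | ctbl_subsets (Hset theta) M /\
      forall p, M p -> P p ->
        exists q, [/\ P q, le q p & forces_same_omega1 M q]].

End Forcing.

Section Namba.
Variables (k l : V).

(* Ideals on [Pk k l] are proper and k-complete, as usual in this context. *)
Record ideal (I : set (set V)) : Prop := Ideal {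
  ideal_sub : forall A, I A -> A `<=` Pk k l;
  ideal_down : forall A B, I B -> A `<=` B -> I A;
  ideal_complete : forall (a : V) (F : V -> set V), a ∈ k ->
    (forall x, x ∈ a -> I (F x)) -> I (\bigcup_(x in elts a) F x);
  ideal_proper : ~ I (Pk k l) }.

Definition fine (I : set (set V)) : Prop :=
  forall x, x ∈ l -> I [set a | Pk k l a /\ ~ x ∈ a].

Definition positive (I : set (set V)) : set (set V) :=
  [set A | A `<=` Pk k l /\ ~ I A].

Definition Jbd : set (set V) :=
  [set A | A `<=` Pk k l /\ exists2 b, Pk k l b & forall a, A a -> ~ b ⊆ a].

Definition incr_seq (n : nat) : set V :=
  [set s | funs (elts (num n)) (Pk k l) s /\
    forall i j a b, i ∈ j -> kpair i a ∈ s -> kpair j b ∈ s -> a ⊆ b].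

Definition rcons_seq (s : V) (n : nat) (x : V) : V :=
  vset (elts s `|` [set kpair (num n) x]).

(* Sequences are functions, so [s ⊆ t] says that [s] is an initial segment of
   [t]. *)
Definition comparable_nodes (p t : V) : Prop :=
  forall s, s ∈ p -> s ⊆ t \/ t ⊆ s.

Definition trunk (p t : V) : Prop :=
  exists n, [/\ incr_seq n t, t ∈ p, comparable_nodes p t &
    forall m u, incr_seq m u -> u ∈ p -> comparable_nodes p u -> (m <= n)%N].

Definition Nm (I : set (set V)) : set V :=
  [set p | [/\ forall s, s ∈ p -> exists n, incr_seq n s,
    forall s m t, s ∈ p -> incr_seq m t -> t ⊆ s -> t ∈ p
  & exists2 t, trunk p t &
      forall s n, s ∈ p -> incr_seq n s -> t ⊆ s ->
        positive I [set x | rcons_seq s n x ∈ p]]].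

Definition Nm_semiproper (I : set (set V)) : Prop :=
  semiproper (Nm I) (fun q p => q ⊆ p).

End Namba.

(* Main.v *)
(* First implication.  By reflection, for club many countable N in [2^(lambda^(<kappa))]^omega
   (coding functions P_kappa(lambda) -> omega1 and subsets of P_kappa(lambda)),
   every positive set A coded in N contains positively many x with
   F(x) in N for all functions F coded in N: otherwise the exceptional N reflect to
   some R of size < kappa; since |[R]^omega| < kappa, completeness of the ideal gives an
   x in A outside all the corresponding null sets, and a set N in [R]^omega closed
   under F |-> F(x) is contradictory.  Given a suitable countable M and a condition
   p in M, this fact, applied to the sets {g(s) : g in M} for nodes s, lets one
   grow a tree q <= p whose nodes s satisfy g(s) in M for every g in M with g(s) < omega1,
   while along each branch the names in M are treated one after the other: at
   a node one passes to a direct extension deciding the name whenever there is one.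
   Then every countable ordinal that an extension of q assigns to a name t in M is
   of the form g(s) with g in M, hence in M.

   Second implication.  J^bd is a fine kappa-complete ideal, by regularity of kappa.

   Third implication.  If S reflects to no R, fix clubs C_R in [R]^omega witnessing this.
   Take M suitable, y in S with y included in M and the same countable ordinals as M, a
   semigeneric q, and extend q so that y is included in the last entry x of its
   trunk.  A member z of C_R, for R the hull of x, is generated by finite subsets of y, so
   its countable ordinals are values of names in M; they belong to M, hence to y,
   contradicting the choice of C_R. *)

Require Import Defs.
From mathcomp Require Import all_boot.
From mathcomp Require Import boolp classical_sets functions cardinality.
From HB Require Import structures.
(* So that [ordinal] means an ordinal of [V] rather than fintype's ['I_n]. *)
Import Defs.

Set Implicit Arguments.
Unset Strict Implicit.
Unset Printing Implicit Defensive.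

Local Open Scope classical_set_scope.
Local Open Scope card_scope.

HB.instance Definition _ := Choice.on V.
HB.instance Definition _ := isPointed.Build V vempty.

(** * Sets in [V] *)

Lemma card_leVP (T : Type) (A : set T) (B : set V) :
  A #<= B <-> exists f : T -> V,
    (forall x, A x -> B (f x)) /\
    (forall x y, A x -> A y -> f x = f y -> x = y).
Proof.
split=> [/pcard_leP/injfunPex[f fAB fi]|[f [fAB fi]]].
  exists f; split=> [x /fAB //|x y Ax Ay]; apply: fi; exact/mem_set.
apply/pcard_leP/injfunPex; exists f => [x /fAB //|x y /set_mem Ax /set_mem Ay].
exact: fi.
Qed.

Lemma small_elts x : small (elts x). Proof. by exists x. Qed.

Lemma small_sub (A B : set V) : small B -> A `<=` B -> small A.
Proof. by move=> [x <-]; exact: separation. Qed.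

Lemma small_image (F : V -> V) (A : set V) : small A -> small (F @` A).
Proof. by move=> [x <-]; exact: replacement. Qed.

Lemma small_bigcup (A : set V) (F : V -> set V) :
  small A -> (forall x, A x -> small (F x)) -> small (\bigcup_(x in A) F x).
Proof.
move=> sA sF.
have /small_image-/(_ (fun x => vset (F x))) [y yE] := sA.
have [z zE] := union y; exists z; rewrite zE yE bigcup_image.
by apply: eq_bigcupr => x Ax; rewrite vsetK //; exact: sF.
Qed.

Lemma small_image2 (F : V -> V -> V) (A B : set V) : small A -> small B ->
  small [set e | exists a b, [/\ A a, B b & e = F a b]].
Proof.
move=> sA sB.
apply: (@small_sub _ (\bigcup_(a in A) (F a @` B))).
  by apply: small_bigcup => // x _; exact: small_image.
by move=> _ [a [b [Aa Bb ->]]]; exists a => //; exists b.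
Qed.

Lemma small2 x y : small [set x; y]. Proof. exact: pairing. Qed.

Lemma small1 x : small [set x].
Proof. by have := pairing x x; rewrite setUid. Qed.


Lemma smallU (A B : set V) : small A -> small B -> small (A `|` B).
Proof.
move=> sA sB.
apply: (@small_sub _ (\bigcup_(b in [set vset A; vset B]) elts b)).
  by apply: small_bigcup => [|x _]; [exact: small2|exact: small_elts].
move=> x [Ax|Bx]; [exists (vset A)|exists (vset B)];
  rewrite ?vsetK //; [by left|by right].
Qed.

Lemma small_leV (A B : set V) : small B -> A #<= B -> small A.
Proof. by move=> sB /pcard_surjP[g gs]; exact: small_sub (small_image g sB) gs. Qed.

Lemma elts_vempty : elts vempty = set0.
Proof. by rewrite elts_pi; apply/seteqP; split=> // x [[]]. Qed.

Lemma vset0 x : ~ x ∈ vempty. Proof. by rewrite elts_vempty. Qed.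

Lemma kpairE x y : elts (kpair x y) = [set vset [set x; x]; vset [set x; y]].
Proof. by rewrite /kpair vsetK //; exact: small2. Qed.

Lemma upairE x y : elts (vset [set x; y]) = [set x; y].
Proof. by rewrite vsetK //; exact: small2. Qed.

Lemma kpair_inj x y x' y' : kpair x y = kpair x' y' -> x = x' /\ y = y'.
Proof.
move=> E.
have in1 : vset [set x; x] ∈ kpair x' y' by rewrite -E kpairE; left.
have in2 : vset [set x; y] ∈ kpair x' y' by rewrite -E kpairE; right.
have in3 : vset [set x'; y'] ∈ kpair x y by rewrite E kpairE; right.
have xx : x = x'.
  move: in1; rewrite kpairE => -[]/(congr1 elts); rewrite !upairE => e.
    by have : [set x; x] x by [left]; rewrite e => -[].
  have : [set x'; y'] x' by left.
  by rewrite -e => -[].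
split=> //; move: in2 in3; rewrite -{}xx {E in1} !kpairE.
move=> -[]/(congr1 elts); rewrite !upairE => e1.
  have yx : y = x by have : [set x; y] y by [right]; rewrite e1 => -[].
  move=> -[]/(congr1 elts); rewrite !upairE => e2;
   by have : [set x; y'] y' by [right]; rewrite e2 ?yx => -[].
move=> _; have [yx|//] : [set x; y'] y by rewrite -e1; right.
have : [set x; y'] y' by right.
by rewrite -e1 yx => -[].
Qed.

Lemma kpair_injl x y x' y' : kpair x y = kpair x' y' -> x = x'.
Proof. by move=> /kpair_inj[]. Qed.
Lemma kpair_injr x y x' y' : kpair x y = kpair x' y' -> y = y'.
Proof. by move=> /kpair_inj[]. Qed.

Lemma mem_irr x : ~ x ∈ x.
Proof. by elim/foundation: x => x IH xx; exact: (IH x). Qed.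

Lemma mem_asym x y : x ∈ y -> ~ y ∈ x.
Proof. by elim/foundation: x y => x IH y xy yx; exact: (IH _ yx x). Qed.

Lemma foundation_min (P : V -> Prop) : (exists x, P x) ->
  exists2 x, P x & forall y, y ∈ x -> ~ P y.
Proof.
move=> [x Px]; apply: contrapT => nmin.
elim/foundation: x Px => x IH Px; apply: nmin; exists x => // y yx; exact: IH.
Qed.

Lemma succE x : elts (succ x) = elts x `|` [set x].
Proof. rewrite vsetK //; apply: smallU; [exact: small_elts|exact: small1]. Qed.

Lemma numE n : elts (num n) = num @` `I_n.
Proof.
elim: n => [|n IH]; first by rewrite elts_vempty; apply/seteqP; split=> // x [].
rewrite [num _]/= succE -/(num n) IH; apply/seteqP; split=> [x [[i /= ni <-]|->]|].
- by exists i => //=; exact: ltnW.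
- by exists n => /=.
- move=> _ [i /= + <-]; rewrite ltnS leq_eqVlt => /orP[/eqP ->|ni]; first by right.
  by left; exists i.
Qed.

Lemma num_mem i j : (i < j)%N -> num i ∈ num j.
Proof. by move=> ij; rewrite numE; exists i. Qed.

Lemma num_inj : injective num.
Proof.
move=> i j E; case: (ltngtP i j) => // /num_mem; rewrite E => /mem_irr //.
Qed.

Lemma mem_num i j : num i ∈ num j -> (i < j)%N.
Proof. by rewrite numE => -[k /= kj /num_inj <-]. Qed.

Lemma omegaE : elts omega = range num.
Proof. by rewrite vsetK //; exact: infinity. Qed.

(** * Ordinals and cardinals *)

Lemma ordinal_elt x y : ordinal x -> y ∈ x -> ordinal y.
Proof. by move=> [tx oy] yx; split=> [|z zy]; [exact: oy|exact/oy/(tx _ yx)]. Qed.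

Lemma ordinalP x :
  transitive_set x -> (forall y, y ∈ x -> ordinal y) -> ordinal x.
Proof. by move=> tx ox; split=> // y /ox[]. Qed.

Lemma ordinal_trichotomy a b :
  ordinal a -> ordinal b -> [\/ a ∈ b, a = b | b ∈ a].
Proof.
elim/foundation: a b => a IHa b oa; elim/foundation: b => b IHb ob.
have [|nab] := pselect (a ∈ b); first by constructor 1.
have [|nba] := pselect (b ∈ a); first by constructor 3.
constructor 2; apply: extensionality; apply/seteqP; split=> x.
  move=> xa; have [//|xb|bx] := IHa _ xa _ (ordinal_elt oa xa) ob.
    by case: nba; rewrite -xb.
  by case: nba; exact: oa.1 bx.
move=> xb; have [ax|ax|//] := IHb _ xb (ordinal_elt ob xb).
  by case: nab; exact: ob.1 ax.
by case: nab; rewrite ax.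
Qed.

Lemma ordinal_total a b : ordinal a -> ordinal b -> a ⊆ b \/ b ∈ a.
Proof.
move=> oa ob; have [ab|->|] := ordinal_trichotomy oa ob; last by right.
  by left; exact: ob.1.
by left.
Qed.

Lemma ordinal_notin a b : ordinal a -> ordinal b -> ~ b ∈ a -> a ⊆ b.
Proof. by move=> oa ob; have [|] := ordinal_total oa ob. Qed.

(** Burali-Forti: a set of all ordinals would be a transitive set of ordinals, hence an ordinal and
    an element of itself. *)
Lemma not_small_ordinal : ~ small ordinal.
Proof.
move=> [x xE]; have ox : ordinal x.
  apply: ordinalP => [y|y]; rewrite xE // => oy z zy.
  exact: ordinal_elt zy.
by apply: (@mem_irr x); rewrite xE.
Qed.

Lemma wf_mem : well_founded (fun x y => x ∈ y).
Proof. by elim/foundation => x IH; constructor. Qed.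

(** * Enumeration of a set along the ordinals *)

Section Enumeration.
Variable A : set V.

(** The recursion runs along membership on all of [V], but only the values at ordinals are used. A
    stage takes an element of [A] not taken before, and [vempty] once [A] is exhausted. *)
Definition enumeration_step (x : V) (F : forall y, y ∈ x -> V) : V :=
  xget vempty [set a | A a /\ forall y (yx : y ∈ x), F y yx <> a].
Definition enumeration : V -> V := Fix wf_mem (fun=> V) enumeration_step.

Lemma enumerationE x : enumeration x =
  xget vempty [set a | A a /\ forall y, y ∈ x -> enumeration y <> a].
Proof.
rewrite /enumeration Fix_eq // => y f g fg.
by congr (enumeration_step _); apply/functional_extensionality_dep => z;
  apply/functional_extensionality_dep => zy.
Qed.

Lemma enumerationP x : ~ A `<=` enumeration @` elts x ->
  A (enumeration x) /\ forall y, y ∈ x -> enumeration y <> enumeration x.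
Proof.
move=> /existsNP[a /not_implyP[Aa na]]; rewrite [enumeration x]enumerationE.
case: xgetP => [b _ //|/(_ a)[]]; split=> // y yx ya.
by apply: na; exists y.
Qed.

(** Otherwise [enumeration] would map the class of ordinals injectively into [A] and make that class
    small. *)
Lemma enumeration_exhausts : small A ->
  exists2 a, ordinal a & A `<=` enumeration @` elts a.
Proof.
move=> sA; apply: contrapT => nexh; apply: not_small_ordinal.
have nexh' a : ordinal a -> ~ A `<=` enumeration @` elts a.
  by move=> oa h; apply: nexh; exists a.
apply: (@small_leV _ A) => //; apply/card_leVP; exists enumeration; split=> [x ox|].
  by have [] := enumerationP (nexh' _ ox).
move=> x y ox oy E; have [xy|//|yx] := ordinal_trichotomy ox oy.
  by have [_ /(_ _ xy)] := enumerationP (nexh' _ oy).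
by have [_ /(_ _ yx)/(_ (esym E))] := enumerationP (nexh' _ ox).
Qed.

(** The least ordinal whose stages cover [A] works: before it every value lies in [A] and no value
    repeats. *)
Lemma ordinal_equipotent : small A -> exists2 a, ordinal a & elts a #= A.
Proof.
move=> sA; have [b ob bA] := enumeration_exhausts sA.
have [|a [oa aA] amin] :=
    @foundation_min (fun a => ordinal a /\ A `<=` enumeration @` elts a).
  by exists b.
have H y : y ∈ a -> A (enumeration y) /\
    forall z, z ∈ y -> enumeration z <> enumeration y.
  move=> ya; apply: enumerationP => Ay; apply: (amin _ ya).
  by split=> //; exact: ordinal_elt ya.
exists a => //; have -> : A = enumeration @` elts a.
  apply/seteqP; split=> // _ [y ya <-]; exact: (H _ ya).1.
apply/card_esym/inj_card_eq => x y /set_mem xa /set_mem ya E.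
have [xy|//|yx] := ordinal_trichotomy (ordinal_elt oa xa) (ordinal_elt oa ya).
  by have [_ /(_ _ xy)] := H _ ya.
by have [_ /(_ _ yx)/(_ (esym E))] := H _ xa.
Qed.

End Enumeration.

Lemma cardinal_equipotent A : small A -> exists k, cardinal k /\ elts k #= A.
Proof.
move=> /ordinal_equipotent[b ob bA].
have [|k [ok kA] kmin] := @foundation_min (fun a => ordinal a /\ elts a #= A).
  by exists b.
exists k; split=> //; split=> // a ak; apply/negP => ka.
apply: (kmin _ ak); split; first exact: ordinal_elt ak.
apply: card_eq_trans kA; rewrite card_eq_le ka andbT.
by apply: subset_card_le; exact: ok.1.
Qed.

Lemma cardVP A : small A -> cardinal (cardV A) /\ elts (cardV A) #= A.
Proof.
by move=> /cardinal_equipotent ex; rewrite /cardV; case: xgetP => // /forallNP.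
Qed.

Lemma cardinal_gt k a : cardinal k -> ordinal a -> ~~ (elts k #<= elts a) -> a ∈ k.
Proof.
move=> [ok _] oa; have [/subset_card_le ->//|//] := ordinal_total ok oa.
Qed.

Lemma card_lt_cardinal k (A : set V) : cardinal k -> small A -> ~~ (elts k #<= A) ->
  exists c, [/\ c ∈ k, cardinal c & elts c #= A].
Proof.
move=> ck /cardinal_equipotent[c [cc cA]] kA; exists c; split=> //.
apply: cardinal_gt => //; first exact: cc.1.
by apply: contra kA; move/card_le_trans; apply; have/card_eqPle[] := cA.
Qed.

Lemma card_lt_elt k a (A : set V) : cardinal k -> a ∈ k -> A #<= elts a ->
  ~~ (elts k #<= A).
Proof.
by move=> [_ ck] /ck + Aa; apply: contra => /card_le_trans; apply.
Qed.

Lemma cardinal_le_sub k l : cardinal k -> ordinal l -> elts k #<= elts l -> k ⊆ l.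
Proof.
by move=> ck ol kl; have [//|/ck.2/negP] := ordinal_total ck.1 ol.
Qed.

Lemma cantor k : ~~ ([set y | y ⊆ k] #<= elts k).
Proof.
apply/negP => /pcard_surjP/=[g gsurj].
pose D := vset [set x | x ∈ k /\ ~ x ∈ g x].
have DE : elts D = [set x | x ∈ k /\ ~ x ∈ g x].
  by rewrite vsetK //; apply: (small_sub (small_elts k)) => x [].
have [|x xk xD] := gsurj D; first by rewrite /= DE => x [].
have nxD : ~ x ∈ D by move=> xxD; move: (xxD); rewrite DE => -[_]; rewrite xD.
by apply: (nxD); rewrite DE; split=> //; rewrite xD.
Qed.

(** By Cantor's theorem the cardinality of the power set of [k] lies above [k], so a least cardinal
    above [k] exists and the choice in [next_cardinal] does not fall back on its default. *)
Lemma next_cardinalP k : cardinal k -> [/\ cardinal (next_cardinal k),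
  k ∈ next_cardinal k & forall m, cardinal m -> k ∈ m -> next_cardinal k ⊆ m].
Proof.
move=> ck; rewrite /next_cardinal; case: xgetP => // nex.
have [l [cl lk]] := cardinal_equipotent (powerset k).
have kl : k ∈ l.
  apply: cardinal_gt => //; first exact: ck.1.
  apply: contra (cantor k); apply: card_le_trans.
  by have/card_eqPle[] := lk.
have [|m [cm km] mmin] := @foundation_min (fun m => cardinal m /\ k ∈ m).
  by exists l.
case: (nex m); split=> // n cn kn.
have [//|nm] := ordinal_total cm.1 cn.1.
by case: (mmin _ nm).
Qed.

Lemma next_cardinal_le k a : cardinal k -> a ∈ next_cardinal k -> elts a #<= elts k.
Proof.
move=> ck ank; have [cn _ nmin] := next_cardinalP ck.
have [c [cc /card_eqPle[ca ac]]] := cardinal_equipotent (small_elts a).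
apply: card_le_trans ac _; apply: subset_card_le.
apply: ordinal_notin; [exact: cc.1|exact: ck.1|move=> kc].
have /(nmin _ cc) nc := kc.
have /negP := cn.2 _ ank; apply.
exact: card_le_trans (subset_card_le nc) ca.
Qed.

Lemma omega_nat : elts omega #= [set: nat].
Proof.
rewrite omegaE; apply: inj_card_eq => x y _ _; exact: num_inj.
Qed.

Lemma ordinal_num n : ordinal (num n).
Proof.
elim/ltn_ind: n => n IH; apply: ordinalP => y; rewrite numE => -[i /= ni <-];
  last exact: IH.
by move=> x; rewrite !numE => -[j /= ji <-]; exists j => //=; exact: ltn_trans ni.
Qed.

Lemma cardinal_omega : cardinal omega.
Proof.
split.
  apply: ordinalP => y; rewrite omegaE => -[n _ <-]; last exact: ordinal_num.
  by rewrite numE => x [i _ <-]; rewrite ?omegaE; exists i.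
move=> a; rewrite omegaE => -[n _ <-]; apply/negP => h.
have : infinite_set (elts (num n)).
  apply/infiniteP; apply: card_le_trans h; rewrite -omegaE.
  by have/card_eqPle[] := omega_nat.
by apply; rewrite numE; apply: finite_image; exact: finite_II.
Qed.

Lemma omega1P : [/\ cardinal omega1, omega ∈ omega1 &
  forall m, cardinal m -> omega ∈ m -> omega1 ⊆ m].
Proof. exact: next_cardinalP cardinal_omega. Qed.

Lemma omega1_in_omega2 : omega1 ∈ omega2.
Proof. by have [c1 _ _] := omega1P; have [] := next_cardinalP c1. Qed.

Lemma small_countable (A : set V) : countable A -> small A.
Proof.
move=> cA; apply: (small_leV (small_elts omega)); apply: card_le_trans cA _.
by have/card_eqPle[] := omega_nat.
Qed.

Lemma uncountable_omega1 : ~ countable (elts omega1).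
Proof.
have [c1 oo _] := omega1P => h; have /negP := c1.2 _ oo; apply.
by apply: card_le_trans h _; have/card_eqPle[] := omega_nat.
Qed.

(** * Regular cardinals *)

Lemma regular_bounded k (A : set V) (f : V -> V) : regular k -> small A ->
  ~~ (elts k #<= A) -> (forall x, A x -> f x ∈ k) ->
  exists2 b, b ∈ k & forall x, A x -> f x ∈ b.
Proof.
move=> [ck _ rk] sA kA fk; have [c [ck' cc cA]] := card_lt_cardinal ck sA kA.
have [A0|[a0 Aa0]] : A = set0 \/ A !=set0.
  by have [->|/eqP/set0P] := pselect (A = set0); [left|right].
  by exists c => //; rewrite A0.
have /pcard_surjP[g gs] : A #<= elts c by have/card_eqPle[] := cA.
(* [g] covers [A] but may leave it; the indices where it does get the harmless value [f a0]. *)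
have [|b bk bf] := rk c (fun x => if pselect (A (g x)) then f (g x) else f a0) ck'.
  by move=> x xc; case: pselect => ? /=; exact: fk.
exists b => // x Ax; have [y yc xE] := gs _ Ax; rewrite -xE in Ax *.
by have := bf y yc; case: pselect.
Qed.

(** Let [g] inject [k] into the union. For each x the indices i with [g i] in [F x] are fewer than
    [k], hence bounded, and these bounds have a common strict bound b. But [g b] lies in some [F x],
    so b is below the bound for x. *)
Lemma regular_bigcup k (A : set V) (F : V -> set V) : regular k -> small A ->
  ~~ (elts k #<= A) -> (forall x, A x -> ~~ (elts k #<= F x)) ->
  ~~ (elts k #<= \bigcup_(x in A) F x).
Proof.
move=> rk sA kA kF; apply/negP => /card_leVP[g [gF gi]].
have ok : ordinal k by case: rk => -[].
have bd x : exists b, A x -> b ∈ k /\ forall i, i ∈ k -> F x (g i) -> i ∈ b.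
  have [Ax|] := pselect (A x); last by exists k.
  have [| | |b bk bK] := @regular_bounded k [set i | i ∈ k /\ F x (g i)] id rk.
  - by apply: (small_sub (small_elts k)) => i [].
  - apply: contra (kF _ Ax) => /card_le_trans; apply.
    apply/card_leVP; exists g; split=> [i [//]|i j [ik _] [jk _]]; exact: gi.
  - by move=> i [].
  by exists b => _; split=> // i ik Fi; apply: bK.
have [f fP] := choice bd.
have [|b bk bf] := regular_bounded rk sA kA (f := f); first by move=> x /fP[].
apply: (@mem_irr b).
have [x Ax Fx] := gF _ bk; have [fk fx] := fP _ Ax.
have ob := ordinal_elt ok bk.
by apply: (ob.1 _ (bf _ Ax)); exact: fx.
Qed.

Lemma regular_setU k (A B : set V) : regular k -> small A -> small B ->
  ~~ (elts k #<= A) -> ~~ (elts k #<= B) -> ~~ (elts k #<= A `|` B).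
Proof.
move=> rk sA sB kA kB; apply/negP => kAB.
have inf T : infinite_set (elts k) -> finite_set (T : set V) -> ~~ (elts k #<= T).
  by move=> ik fT; apply/negP => /card_le_finite; auto.
have : ~~ (elts k #<= \bigcup_(x in [set vset A; vset B]) elts x).
  apply: regular_bigcup => //; first exact: small2.
    by case: rk => _ ik _; apply: inf => //; exact: finite_set2.
  by move=> _ [->|->]; rewrite vsetK.
move=> /negP; apply; apply: card_le_trans kAB _; apply: subset_card_le => x [Ax|Bx].
  by exists (vset A); [left|rewrite vsetK].
by exists (vset B); [right|rewrite vsetK].
Qed.

Lemma countable_lt k (A : set V) : cardinal k -> omega1 ∈ k -> countable A ->
  ~~ (elts k #<= A).
Proof.
move=> ck ok cA; have [[o1 _] oo _] := omega1P.
apply: (card_lt_elt ck ok); apply: card_le_trans cA _.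
have : [set: nat] #<= elts omega by have/card_eqPle[] := omega_nat.
by move/card_le_trans; apply; apply/subset_card_le/o1.1.
Qed.

(** * Cardinals with an injective pairing, and regularity of their successors *)

Section SquareCardinal.
Variables (k : V) (pr : V -> V -> V) (z0 z1 : V).
Hypothesis pr_mem : forall x y, x ∈ k -> y ∈ k -> pr x y ∈ k.
Hypothesis pr_inj : forall x y x' y', x ∈ k -> y ∈ k -> x' ∈ k -> y' ∈ k ->
  pr x y = pr x' y' -> x = x' /\ y = y'.
Hypotheses (z0k : z0 ∈ k) (z1k : z1 ∈ k) (z01 : z0 <> z1).

Lemma sq_bigcup (A : set V) (F : V -> set V) : A #<= elts k ->
  (forall x, A x -> F x #<= elts k) -> \bigcup_(x in A) F x #<= elts k.
Proof.
move=> /card_leVP[i [ik ii]] Fk.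
have Fk' x : exists j : V -> V, A x -> (forall y, F x y -> j y ∈ k) /\
    (forall y z, F x y -> F x z -> j y = j z -> y = z).
  have [/Fk/card_leVP[j jP]|] := pselect (A x); last by exists id.
  by exists j.
have [j jP] := choice Fk'.
have ch y : exists x, (\bigcup_(x in A) F x) y -> A x /\ F x y.
  have [[x Ax Fx]|] := pselect ((\bigcup_(x in A) F x) y); last by exists y.
  by exists x.
have [c cP] := choice ch.
apply/card_leVP; exists (fun y => pr (i (c y)) (j (c y) y)); split=> [y|y z].
  by move=> /cP[Ac Fc]; apply: pr_mem; [exact: ik|exact: (jP _ Ac).1].
move=> /cP[Ay Fy] /cP[Az Fz] E.
have [/(ii _ _ Ay Az) cE jE] := pr_inj (ik _ Ay) ((jP _ Ay).1 _ Fy)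
  (ik _ Az) ((jP _ Az).1 _ Fz) E.
by rewrite -cE in Fz jE; exact: (jP _ Ay).2 jE.
Qed.

Lemma sq_setU (A B : set V) : A #<= elts k -> B #<= elts k -> A `|` B #<= elts k.
Proof.
move=> /card_leVP[i [ik ii]] /card_leVP[j [jk ji]].
apply/card_leVP; exists (fun y => if pselect (A y) then pr z0 (i y) else pr z1 (j y)).
split=> [y ABy|y z ABy ABz].
  case: pselect => Ay; apply: pr_mem => //; first exact: ik.
  by apply: jk; case: ABy.
case: pselect => [Ay|nAy]; case: pselect => [Az|nAz] E.
- by have [_ /ii] := pr_inj z0k (ik _ Ay) z0k (ik _ Az) E; apply.
- have Bz : B z by case: ABz.
  by have [/z01] := pr_inj z0k (ik _ Ay) z1k (jk _ Bz) E.
- have By : B y by case: ABy.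
  by have [/esym/z01] := pr_inj z1k (jk _ By) z0k (ik _ Az) E.
- have Bz : B z by case: ABz.
  have By : B y by case: ABy.
  by have [_ /ji] := pr_inj z1k (jk _ By) z1k (jk _ Bz) E; apply.
Qed.

(** If f were unbounded on a, each y in the successor cardinal would be below or equal to some
    [f x]. The successor would then be covered by at most [k] sets of size at most [k] and the image
    of a, so it would have size at most [k]. *)
Lemma sq_regular_next : cardinal k -> omega ⊆ k -> regular (next_cardinal k).
Proof.
move=> ck ok; have [cn kn _] := next_cardinalP ck.
have on : ordinal (next_cardinal k) by case: cn.
split=> //.
  apply/infiniteP.
  have : [set: nat] #<= elts omega by have/card_eqPle[] := omega_nat.
  move/card_le_trans; apply; apply: subset_card_le => x /ok; exact: on.1.
move=> a f an fn; apply: contrapT => nb.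
have /negP := cn.2 _ kn; apply.
apply: (@card_le_trans _ _ _ ((\bigcup_(x in elts a) elts (f x)) `|` f @` elts a)).
  apply: subset_card_le => y yn; apply: contrapT => ny; apply: nb.
  exists y => // x xa; have ofx := ordinal_elt on (fn _ xa).
  have [//|fy|yf] := ordinal_trichotomy ofx (ordinal_elt on yn).
    by case: ny; right; exists x.
  by case: ny; left; exists x.
have ak := next_cardinal_le ck an.
apply: sq_setU; last exact: card_le_trans (card_image_le _ _) ak.
by apply: sq_bigcup => // x /fn; exact: next_cardinal_le.
Qed.

End SquareCardinal.

(** Closure under tagging by numerals lets subsets of x be joined disjointly inside x, which gives
    the power set of x a pairing. *)
Lemma tag_closure (A : set V) : small A -> exists x, A `<=` elts x /\
  forall i y, y ∈ x -> kpair (num i) y ∈ x.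
Proof.
move=> sA; pose it := fun n => iter n
  (fun B : set V => [set e | exists i y, [/\ elts omega i, B y & e = kpair i y]]) A.
have sit n : small (it n).
  elim: n => // n IH; apply: small_image2 => //; exact: small_elts.
have sU : small (\bigcup_n it n).
  apply: (@small_sub _ (\bigcup_(x in range (fun n => vset (it n))) elts x)).
    apply: small_bigcup => [|x _]; [exact: infinity|exact: small_elts].
  move=> x [n _ xn]; exists (vset (it n)); first by exists n.
  by rewrite vsetK.
exists (vset (\bigcup_n it n)); rewrite vsetK //; split=> [x Ax|i y [n _ yn]].
  by exists 0%N.
by exists n.+1 => //; exists (num i), y; split=> //; rewrite omegaE; exists i.
Qed.

(** The power set C of a set closed under tags has the injective pairing [pr], a disjoint union of
    tagged copies. It is transported to the cardinality k of C, so the successor of k is regular;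
    singletons embed A into C. *)
Lemma large_regular (A : set V) : small A ->
  exists2 theta, regular theta & ~~ (elts theta #<= A).
Proof.
move=> sA; have [x [Ax xt]] := tag_closure (smallU sA (small_elts omega)).
have ox : omega ⊆ x by move=> y yo; apply: Ax; right.
have {}Ax : A `<=` elts x by move=> y Ay; apply: Ax; left.
pose C := [set y | y ⊆ x].
have sC : small C by exact: powerset.
pose tag i y := [set kpair (num i) z | z in elts y].
pose pr y y' := vset (tag 0%N y `|` tag 1%N y').
have sT i y : small (tag i y) by apply/small_image/small_elts.
have prE y y' : elts (pr y y') = tag 0%N y `|` tag 1%N y'.
  by rewrite vsetK //; exact: smallU.
have prC y y' : C y -> C y' -> C (pr y y').
  move=> Cy Cy' z; rewrite prE => -[] [w wy <-]; apply: xt; auto.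
have pr_inj y1 y2 y1' y2' : pr y1 y2 = pr y1' y2' -> y1 = y1' /\ y2 = y2'.
  move=> /(congr1 elts); rewrite !prE => /seteqP[h1 h2].
  split; apply: extensionality; apply/seteqP; split=> z zy.
  - have [|[w wy /kpair_injr <- //]|[w wy /kpair_injl/num_inj//]] :=
      h1 (kpair (num 0) z); by left; exists z.
  - have [|[w wy /kpair_injr <- //]|[w wy /kpair_injl/num_inj//]] :=
      h2 (kpair (num 0) z); by left; exists z.
  - have [|[w wy /kpair_injl/num_inj//]|[w wy /kpair_injr <- //]] :=
      h1 (kpair (num 1) z); by right; exists z.
  - have [|[w wy /kpair_injl/num_inj//]|[w wy /kpair_injr <- //]] :=
      h2 (kpair (num 1) z); by right; exists z.
have [k [ck /card_eqPle[kC Ck]]] := cardinal_equipotent sC.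
have AC : A #<= C.
  apply/card_leVP; exists (fun y => vset [set y; y]).
  split=> [y Ay z|y z Ay Az /(congr1 elts)]; rewrite !upairE.
    by case=> ->; exact: Ax.
  by move=> E; have : [set z; z] y by [rewrite -E; left]; case.
have Ak : A #<= elts k by exact: card_le_trans Ck.
have [e [eC ei]] := (card_leVP _ _).1 kC; have [d [dk di]] := (card_leVP _ _).1 Ck.
have okx : elts omega #<= elts k.
  apply: card_le_trans Ck; apply: card_le_trans (subset_card_le ox) _.
  apply/card_leVP; exists (fun y => vset [set y; y]).
  split=> [y Ay z|y z Ay Az /(congr1 elts)]; rewrite !upairE.
    by case=> ->.
  by move=> E; have : [set z; z] y by [rewrite -E; left]; case.
have ok : omega ⊆ k := cardinal_le_sub cardinal_omega ck.1 okx.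
have [cn kn _] := next_cardinalP ck.
exists (next_cardinal k); last exact: card_lt_elt Ak.
apply: (@sq_regular_next k (fun y z => d (pr (e y) (e z))) (num 0) (num 1)) => //.
- by move=> y z yk zk; apply/dk/prC; apply: eC.
- move=> y z y' z' yk zk y'k z'k E.
  have [] := @pr_inj (e y) (e z) (e y') (e z').
    by apply: di E; apply: prC; apply: eC.
  by move=> /ei-> // /ei->.
- by apply: ok; rewrite omegaE; exists 0%N.
- by apply: ok; rewrite omegaE; exists 1%N.
- by move/num_inj.
Qed.

Lemma trcl_sub x y : trcl x y -> trcl y `<=` trcl x.
Proof.
move=> xy z; elim=> [w wy|w u _ xw uw]; first exact: trcl_step wy.
exact: trcl_step uw.
Qed.

Lemma small_trcl x : small (trcl x).
Proof.
elim/foundation: x => x IH.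
apply: (@small_sub _ (elts x `|` \bigcup_(y in elts x) trcl y)).
  apply: smallU; first exact: small_elts.
  by apply: small_bigcup => //; exact: small_elts.
move=> z; elim=> [w wx|w u _ [wx|[v vx vw]] uw]; first by left.
  by right; exists w => //; exact: trcl_elt.
by right; exists v => //; exact: trcl_step uw.
Qed.

Lemma Hset_trcl theta x : ~~ (elts theta #<= trcl x) -> trcl x `<=` Hset theta.
Proof.
move=> tx y /trcl_sub yx; apply: contra tx => /card_le_trans; apply.
exact: subset_card_le.
Qed.

(** * Clubs *)

Definition lsub (l : seq V) (x : set V) := forall v, v \in l -> x v.

Lemma lsub_cons a l x : lsub (a :: l) x <-> x a /\ lsub l x.
Proof.
split=> [h|[xa h] v]; last by rewrite inE => /orP[/eqP ->|/h].
by split=> [|v vl]; apply: h; rewrite inE ?eqxx // vl orbT.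
Qed.

Lemma lsub_sub l (x y : set V) : x `<=` y -> lsub l x -> lsub l y.
Proof. by move=> xy h v /h/xy. Qed.

Lemma lsub_bigcup l (u : nat -> set V) : (forall n, u n `<=` u n.+1) ->
  lsub l (\bigcup_n u n) -> exists n, lsub l (u n).
Proof.
move=> uS; have um m n : (m <= n)%N -> u m `<=` u n.
  by move=> /subnK <-; elim: (n - m)%N => // i IH; apply: (subset_trans IH); exact: uS.
elim: l => [_|a l IH /lsub_cons[[m _ um'] /IH[n hn]]]; first by exists 0%N.
exists (maxn m n); apply/lsub_cons; split.
  by apply: um um'; exact: leq_maxl.
by apply: lsub_sub hn; apply: um; exact: leq_maxr.
Qed.

Lemma lsub_range l (a : nat -> V) : lsub l (range a) -> exists s, l = map a s.
Proof.
elim: l => [_|v l IH /lsub_cons[[n _ <-] /IH[s ->]]]; first by exists [::].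
by exists (n :: s).
Qed.

Lemma ctbl_subsetsP (W x : set V) : ctbl_subsets W x <->
  [/\ x `<=` W, countable x & infinite_set x].
Proof.
split=> [[xW]|[xW cx /infiniteP ix]]; first rewrite card_eq_le => /andP[cx /infiniteP].
  by split.
by split=> //; rewrite card_eq_le ix andbT.
Qed.

Lemma countable_range (x : set V) : x !=set0 -> countable x ->
  exists a : nat -> V, x = range a.
Proof.
move=> [v0 xv0] /pcard_surjP[g gs].
exists (fun n => if pselect (x (g n)) then g n else v0).
apply/seteqP; split=> [v xv|_ [n _ <-]]; last by case: pselect.
have [n _ nv] := gs _ xv; exists n => //; rewrite nv.
by case: pselect.
Qed.

Lemma ctbl_subsets_range (W x : set V) : ctbl_subsets W x ->
  exists a : nat -> V, x = range a.
Proof.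
move=> /ctbl_subsetsP[_ cx ix]; apply: countable_range cx.
exact: infinite_setN0.
Qed.

Lemma countable_rangeT (T : countType) (f : T -> V) : countable (range f).
Proof. exact: card_le_trans (card_image_le _ _) (countableP _). Qed.

Lemma countable_bigcup_nat (u : nat -> set V) : (forall n, countable (u n)) ->
  countable (\bigcup_n u n).
Proof. by move=> cu; apply: bigcup_countable => //; exact: countableP. Qed.

Lemma countable_setU (x y : set V) : countable x -> countable y ->
  countable (x `|` y).
Proof.
move=> cx cy; rewrite -bigcup2E; apply: countable_bigcup_nat => -[|[|n]] //=.
Qed.

(** Countably many finitary operations, indexed by i. A value outside [H] imposes nothing, so
    partial operations on [H] may be written as total functions on [V]. *)
Definition closed_under (H : set V) (O : nat -> seq V -> V) (x : set V) :=
  forall i l, lsub l x -> H (O i l) -> x (O i l).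

Section Closure.
Variables (H : set V) (O : nat -> seq V -> V).

Definition closure_step (x : set V) : set V :=
  x `|` [set v | exists i l, [/\ lsub l x, H (O i l) & v = O i l]].
Definition op_closure (x : set V) : set V := \bigcup_n iter n closure_step x.

Lemma op_closure_sub x : x `<=` op_closure x.
Proof. by move=> v xv; exists 0%N. Qed.

Lemma op_closure_closed x : closed_under H O (op_closure x).
Proof.
move=> i l /lsub_bigcup[n v|n ln HO]; first by left.
by exists n.+1 => //; right; exists i, l.
Qed.

Lemma op_closure_in x : x `<=` H -> op_closure x `<=` H.
Proof.
move=> xH v [n _]; elim: n v => [|n IH] v; first exact: xH.
by move=> [/IH //|[i [l [_ ? ->]]]].
Qed.

Lemma countable_closure_step x : countable x -> countable (closure_step x).
Proof.
move=> cx; apply: countable_setU => //.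
have [x0|/set0P x0] := eqVneq x set0.
  apply: sub_countable (countable_rangeT (fun i => O i [::])).
  apply: subset_card_le => v [i [[|a l] [la _ ->]]]; first by exists i.
  by have /lsub_cons[] := la; rewrite x0.
have [a aE] := countable_range x0 cx.
apply: sub_countable
  (countable_rangeT (fun p : nat * seq nat => O p.1 (map a p.2))).
apply: subset_card_le => v [i [l [+ _ ->]]]; rewrite aE => /lsub_range[s ->].
by exists (i, s).
Qed.

Lemma countable_op_closure x : countable x -> countable (op_closure x).
Proof.
move=> cx; apply: countable_bigcup_nat; elim=> // n IH.
exact: countable_closure_step.
Qed.

(** The closure of a countable set is countable because there are countably many finite lists over
    it; a finite list in an increasing union already lies in one term. *)
Lemma club_closed_under :
  club H [set x | ctbl_subsets H x /\ closed_under H O x].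
Proof.
split=> [x [] //|x cx|u uC uS].
  exists (op_closure x); last exact: op_closure_sub.
  move/ctbl_subsetsP: cx => [xH cx ix]; split; last exact: op_closure_closed.
  apply/ctbl_subsetsP; split; first exact: op_closure_in.
    exact: countable_op_closure.
  exact: sub_infinite_set (@op_closure_sub x) ix.
have uct n := (ctbl_subsetsP _ _).1 (uC n).1.
split.
  apply/ctbl_subsetsP; split.
  - by move=> v [n _ uv]; have [uH _ _] := uct n; exact: uH.
  - by apply: countable_bigcup_nat => n; have [] := uct n.
  - have [_ _] := uct 0%N; apply: sub_infinite_set => v uv; by exists 0%N.
move=> i l /lsub_bigcup[//|n ln] HO; exists n => //; exact: (uC n).2.
Qed.

End Closure.

Lemma infinite_ctbl_subset (W : set V) : infinite_set W ->
  exists x, ctbl_subsets W x.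
Proof.
move=> /infiniteP /card_leVP[f [fW fi]]; exists (range f); split.
  by move=> _ [n _ <-]; exact: fW.
by apply: inj_card_eq => m n _ _; apply: fi.
Qed.

(** The newest entry is at the head, as in the lists that represent nodes of trees. *)
Fixpoint prefix (a : nat -> V) (n : nat) : seq V :=
  if n is n'.+1 then a n' :: prefix a n' else [::].

Lemma lsub_prefix a n x : range a `<=` x -> lsub (prefix a n) x.
Proof.
move=> ax; elim: n => //= n IH; apply/lsub_cons; split=> //.
by apply: ax; exists n.
Qed.

(* Kueker: every member of an increasing union of values of [G] is a value of
   [G] on a finite subset, whence [C] contains all sets closed under [G]. *)
Lemma club_kueker (W : set V) C : infinite_set W -> club W C ->
  exists G : seq V -> nat -> V, (forall e k, lsub e W -> W (G e k)) /\
    forall a : nat -> V, range a `<=` W ->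
      range a `<=` [set v | exists n k, v = G (prefix a n) k] /\
      C [set v | exists n k, v = G (prefix a n) k].
Proof.
move=> iW [CW Cunb Cchain].
have [x0 cx0] := infinite_ctbl_subset iW.
have [c0 Cc0 _] := Cunb _ cx0.
have ext (a : V) (c : set V) : exists d : set V, C c -> W a ->
    [/\ C d, c `<=` d & d a].
  have [[Cc Wa]|nh] := pselect (C c /\ W a); last first.
    by exists set0 => ? ?; case: nh.
  have [|d Cd cd] := Cunb (c `|` [set a]).
    have /ctbl_subsetsP[cW cc ic] := CW _ Cc.
    apply/ctbl_subsetsP; split.
    - by move=> v [/cW//|->].
    - by apply: countable_setU => //; exact: countable1.
    - by apply: sub_infinite_set ic => v cv; left.
  by exists d => _ _; split=> // [v cv|]; apply: cd; [left|right].
have [ex exP] := choice (fun p : V * set V => ext p.1 p.2).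
(* K attaches to a list a member of C containing its entries, by adding them one at a time. It
   depends on the order of the list, but along the prefixes of one enumeration it increases. *)
pose K := fix K e := if e is a :: e' then ex (a, K e') else c0.
have CK e : lsub e W -> C (K e).
  by elim: e => //= a e IH /lsub_cons[Wa /IH Ke]; have [] := exP (a, K e) Ke Wa.
have rng e : exists g : nat -> V, lsub e W -> K e = range g.
  have [/CK/CW/ctbl_subsets_range[g]|] := pselect (lsub e W); last by exists (fun=> vempty).
  by exists g.
have [G GP] := choice rng.
exists G; split=> [e k eW|a aW].
  have /CW[KW _] := CK _ eW; apply: KW; rewrite GP //; by exists k.
have pW n : lsub (prefix a n) W by exact: lsub_prefix.
have Wa n : W (a n) by apply: aW; exists n.
have -> : [set v | exists n k, v = G (prefix a n) k] = \bigcup_n K (prefix a n).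
  apply/seteqP; split=> [_ [n [k ->]]|v [n _]].
    by exists n => //; rewrite GP //; exists k.
  by rewrite GP // => -[k _ <-]; exists n, k.
split=> [_ [n _ <-]|].
  by exists n.+1 => //=; have [] := exP (a n, K (prefix a n)) (CK _ (pW n)) (Wa n).
apply: Cchain => n; first exact: CK.
by have [] := exP (a n, K (prefix a n)) (CK _ (pW n)) (Wa n).
Qed.

(** A countable set closed under [G] is exactly the set generated from an enumeration of itself. *)
Lemma club_kueker_closed (W : set V) C : infinite_set W -> club W C ->
  exists G : seq V -> nat -> V, (forall e k, lsub e W -> W (G e k)) /\
    forall x, x !=set0 -> countable x -> x `<=` W ->
      (forall e k, lsub e x -> x (G e k)) -> C x.
Proof.
move=> iW cC; have [G [GW GP]] := club_kueker iW cC; exists G; split=> // x x0 cx xW xG.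
have [a aE] := countable_range x0 cx.
have [|aS] := GP a; first by rewrite -aE.
suff -> : [set v | exists n k, v = G (prefix a n) k] = x by [].
apply/seteqP; split=> [_ [n [k ->]]|v]; last by rewrite {1}aE => /aS.
by apply: xG; apply: lsub_prefix; rewrite aE.
Qed.

(** * Forcing *)

Lemma kpair_trcl x y : trcl (kpair x y) x.
Proof.
apply: (@trcl_step _ (vset [set x; x])); last by rewrite upairE; left.
by apply: trcl_elt; rewrite kpairE; left.
Qed.

(** Here z is not a member of x but lies in its transitive closure, so the induction carries Q for
    the whole transitive closure. *)
Lemma name_induction (Q : V -> Prop) :
  (forall x, (forall z s, kpair z s ∈ x -> Q z) -> Q x) -> forall x, Q x.
Proof.
move=> step x; suff : Q x /\ forall y, trcl x y -> Q y by case.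
elim/foundation: x => x IH.
have tx y : trcl x y -> Q y.
  suff : trcl x y -> exists2 w, w ∈ x & y = w \/ trcl w y.
    by move=> /[apply] -[w /IH[Qw Tw] [->|/Tw]].
  elim=> [w wx|z w _ [u ux uz] wz]; first by exists w => //; left.
  exists u => //; right; case: uz => [<-|uz]; first exact: trcl_elt.
  exact: trcl_step wz.
split=> //; apply: step => z s zx; apply: tx.
by apply: (trcl_sub (trcl_elt zx)); exact: kpair_trcl.
Qed.

(** * Check names, forced equality, and semigenericity *)

Section ForcingTheory.
Variables (P : set V) (le : V -> V -> Prop).
Hypotheses (sP : small P) (le_refl : forall p, le p p)
  (le_trans : forall q p r, le p q -> le q r -> le p r).

Local Notation feq := (forces_eq P le).
Local Notation chk := (check P).

Lemma check_treeE A (f : A -> tree) : elts (check_tree P (Sup f)) =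
  [set e | exists a p, P p /\ e = kpair (check_tree P (f a)) p].
Proof.
rewrite [check_tree _ _]/= vsetK //.
apply: (@small_sub _ [set e | exists a p,
    [/\ range (fun a => check_tree P (f a)) a, P p & e = kpair a p]]).
  apply: small_image2 => //.
  by apply: (@small_range _ (fun a => repr (check_tree P (f a)))) => a; rewrite reprK.
by move=> _ [a [p [Pp ->]]]; exists (check_tree P (f a)), p; split=> //; exists a.
Qed.

(** Makes [check] independent of the representative chosen by [repr], whence the recursion equation
    [checkE]. *)
Lemma check_tree_eqtree t u : eqtree t u -> check_tree P t = check_tree P u.
Proof.
elim: t u => A f IH [B g] [h1 h2]; apply: extensionality; rewrite !check_treeE.
apply/seteqP; split=> _ [a [p [Pp ->]]].
  by have [b /IH ->] := h1 a; exists b, p.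
by have [b /IH <-] := h2 a; exists b, p.
Qed.

Lemma checkE x : elts (chk x) =
  [set e | exists y p, [/\ y ∈ x, P p & e = kpair (chk y) p]].
Proof.
have [A [f [-> ->]]] := elts_range x.
have chk_pi t : chk (\pi_V t)%qT = check_tree P t.
  by apply: check_tree_eqtree; apply/pi_eqtree; rewrite reprK.
rewrite chk_pi check_treeE; apply/seteqP; split=> [_ [a [p [Pp ->]]]|].
  by exists (\pi_V (f a))%qT, p; rewrite chk_pi; split=> //; exists a.
by move=> _ [_ [p [[a _ <-] Pp ->]]]; exists a, p; rewrite /= chk_pi.
Qed.

Lemma check_mem x y p : y ∈ x -> P p -> kpair (chk y) p ∈ chk x.
Proof. by rewrite checkE => yx Pp; exists y, p. Qed.

Lemma mem_check x z s : kpair z s ∈ chk x -> exists2 y, y ∈ x & z = chk y.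
Proof. by rewrite checkE => -[y [p [yx _ /kpair_injl ->]]]; exists y. Qed.

Lemma name_check x : name P (chk x).
Proof.
elim/foundation: x => x IH; constructor => e; rewrite checkE => -[y [p [yx Pp ->]]].
by exists (chk y), p; split=> //; exact: IH.
Qed.

Lemma forces_eqP p x y : feq p x y <->
  (forall z s q, kpair z s ∈ x -> P q -> le q p -> le q s ->
     exists r w t, [/\ P r, le r q, kpair w t ∈ y, le r t & feq r z w]) /\
  (forall w t q, kpair w t ∈ y -> P q -> le q p -> le q t ->
     exists r z s, [/\ P r, le r q, kpair z s ∈ x, le r s & feq r z w]).
Proof. by split=> [[]|[]]; [split|constructor]. Qed.

Lemma forces_eq_mono p q x y : le q p -> feq p x y -> feq q x y.
Proof.
move=> qp /forces_eqP[h1 h2]; apply/forces_eqP; split=> z s r zx Pr rq.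
  by apply: h1 zx Pr _; exact: le_trans qp.
by apply: h2 zx Pr _; exact: le_trans qp.
Qed.

Lemma forces_eq_refl p x : feq p x x.
Proof.
elim/name_induction: x p => x IH p; apply/forces_eqP.
by split=> z s q zx Pq qp qs; exists q, z, s; split=> //; exact: IH zx _.
Qed.

Lemma forces_eq_sym p x y : feq p x y -> feq p y x.
Proof.
elim/name_induction: x p y => x IH p y /forces_eqP[h1 h2]; apply/forces_eqP.
split=> z s q zx Pq qp qs.
  have [r [w [t [Pr rq wx rt rw]]]] := h2 _ _ _ zx Pq qp qs.
  by exists r, w, t; split=> //; exact: IH wx _ _ _.
have [r [w [t [Pr rq wx rt rw]]]] := h1 _ _ _ zx Pq qp qs.
by exists r, w, t; split=> //; exact: IH zx _ _ _.
Qed.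

Lemma forces_eq_trans p x y z : feq p x y -> feq p y z -> feq p x z.
Proof.
elim/name_induction: x p y z => x IH p y z /forces_eqP[xy yx] /forces_eqP[yz zy].
apply/forces_eqP; split=> a s q ax Pq qp qs.
  have [r [b [t [Pr rq bY rt ab]]]] := xy _ _ _ ax Pq qp qs.
  have [r' [c [u [Pr' r'r cz r'u bc]]]] := yz _ _ _ bY Pr (le_trans rq qp) rt.
  exists r', c, u; split=> //; first exact: le_trans rq.
  by apply: IH ax _ _ _ _ bc; exact: forces_eq_mono ab.
have [r [b [t [Pr rq bY rt ba]]]] := zy _ _ _ ax Pq qp qs.
have [r' [c [u [Pr' r'r cx r'u cb]]]] := yx _ _ _ bY Pr (le_trans rq qp) rt.
exists r', c, u; split=> //; first exact: le_trans rq.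
by apply: IH cx _ _ _ cb _; exact: forces_eq_mono ba.
Qed.

Lemma forces_eq_check p x y : P p -> feq p (chk x) (chk y) -> x = y.
Proof.
move=> Pp; elim/foundation: x p Pp y => x IH p Pp y /forces_eqP[h1 h2].
apply: extensionality; apply/seteqP; split=> z zx.
  have [r [w [t [Pr _ /mem_check[z' z'y ->] _ E]]]] :=
    h1 _ _ _ (check_mem zx Pp) Pp (le_refl _) (le_refl _).
  by rewrite (IH _ zx _ Pr _ E).
have [r [w [t [Pr _ /mem_check[z' z'y wE] _ E]]]] :=
  h2 _ _ _ (check_mem zx Pp) Pp (le_refl _) (le_refl _).
by rewrite wE in E; rewrite -(IH _ z'y _ Pr _ E).
Qed.

Lemma ext_nameE M : countable M -> elts (ext_name P M) =
  [set e | exists t p, [/\ M t, name P t, P p & e = kpair t p]].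
Proof.
move=> cM; rewrite vsetK //; apply: (small_sub (small_image2 kpair (small_countable cM) sP)).
by move=> e [t [p [Mt _ Pp ->]]]; exists t, p.
Qed.

Lemma f_in_check x y z p : z ∈ y -> feq p x (chk z) -> f_in P le x (chk y) p.
Proof.
move=> zy xz q Pq qp; exists q, (chk z), q; split=> //; first exact: check_mem.
exact: forces_eq_mono xz.
Qed.

Lemma f_in_checkE x y p : f_in P le x (chk y) p -> P p ->
  exists r z, [/\ P r, le r p, z ∈ y & feq r x (chk z)].
Proof.
move=> h Pp; have [r [w [s [Pr rp /mem_check[z zy ->] _ E]]]] := h p Pp (le_refl _).
by exists r, z.
Qed.

Lemma f_in_ext M x t p : countable M -> M t -> name P t -> feq p x t ->
  f_in P le x (ext_name P M) p.
Proof.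
move=> cM Mt nt xt q Pq qp; exists q, t, q; split=> //.
  by rewrite ext_nameE //; exists t, q.
exact: forces_eq_mono xt.
Qed.

Lemma trace_omega1E (M : set V) : countable M ->
  elts (vset (M `&` elts omega1)) = M `&` elts omega1.
Proof. by move=> /small_countable/small_sub sM; rewrite vsetK //; apply: sM => x []. Qed.

(** After two extensions, an element of M[G] that is a countable ordinal equals both a name t in [M]
    and a check name of some z, and the hypothesis on decided values puts z in [M]. The converse
    inclusion uses that [M] contains the check names of its countable ordinals. *)
Lemma forces_same_omega1I M q : countable M ->
  (forall x, M x -> x ∈ omega1 -> M (chk x)) ->
  (forall t r x, M t -> P r -> le r q -> x ∈ omega1 -> feq r t (chk x) -> M x) ->
  forces_same_omega1 P le M q.
Proof.
move=> cM Mc Mq x _; split=> r Pr rq [A nB].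
  have [r1 [t [s [Pr1 r1r]]]] := A.1 r Pr (le_refl _).
  rewrite ext_nameE // => -[t' [_ [Mt _ _ /kpair_injl E]]] _ xt.
  subst t'; have h2 : f_in P le x (chk omega1) r1.
    by move=> q' Pq' q'r1; apply: A.2 => //; exact: le_trans r1r.
  have [r2 [z [Pr2 r21 zo xz]]] := f_in_checkE h2 Pr1.
  apply: (nB r2 Pr2 (le_trans r21 r1r)).
  apply: (f_in_check _ xz); rewrite trace_omega1E //; split=> //.
  apply: (Mq t r2) => //; first exact: le_trans (le_trans r21 r1r) rq.
  by apply: forces_eq_trans xz; apply: forces_eq_sym; exact: forces_eq_mono xt.
have [r1 [z [Pr1 r1r]]] := f_in_checkE A Pr.
rewrite trace_omega1E // => -[Mz zo] xz; apply: (nB r1 Pr1 r1r); split.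
  by apply: f_in_ext xz; [|exact: Mc|exact: name_check].
exact: f_in_check xz.
Qed.

(** The formula is instantiated at the name t: if x were not in [M], then r would force t into M[G]
    and into omega1 but out of the trace of [M] on omega1. *)
Lemma forces_same_omega1E M q r t x : countable M -> forces_same_omega1 P le M q ->
  P r -> le r q -> M t -> name P t -> x ∈ omega1 -> feq r t (chk x) -> M x.
Proof.
move=> cM /(_ t) Mq Pr rq Mt nt xo tx; have [+ _] := Mq nt => /(_ r Pr rq).
apply: contra_notP => nMx; split.
  split; last exact: f_in_check tx.
  by apply: (@f_in_ext _ _ t) => //; exact: forces_eq_refl.
move=> r1 Pr1 r1r /f_in_checkE/(_ Pr1)[r2 [z [Pr2 r21]]].
rewrite trace_omega1E // => -[Mz zo] tz; apply: nMx.
rewrite (@forces_eq_check r2 x z) //; apply: forces_eq_trans tz.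
by apply: forces_eq_sym; apply: forces_eq_mono tx; exact: le_trans r1r.
Qed.

End ForcingTheory.

(** * Trees of finite sequences *)

Definition sfx (s t : seq V) := exists u, t = u ++ s.

Lemma sfx_refl s : sfx s s. Proof. by exists [::]. Qed.
Lemma sfx_cons x s : sfx s (x :: s). Proof. by exists [:: x]. Qed.
Lemma sfx_nil s : sfx [::] s. Proof. by exists s; rewrite cats0. Qed.
Lemma sfx_trans t s u : sfx s t -> sfx t u -> sfx s u.
Proof. by move=> [v ->] [w ->]; exists (w ++ v); rewrite catA. Qed.
Lemma sfx_size s t : sfx s t -> (size s <= size t)%N.
Proof. by move=> [u ->]; rewrite size_cat leq_addl. Qed.
Lemma sfx_size_eq s t : sfx s t -> (size t <= size s)%N -> s = t.
Proof.
by move=> [[//|x u] ->]; rewrite size_cat /= leqNgt ltnS leq_addl.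
Qed.
Lemma sfx_antisym s t : sfx s t -> sfx t s -> s = t.
Proof. by move=> st /sfx_size; exact: sfx_size_eq. Qed.
Lemma sfx_consE s x t : sfx s (x :: t) -> s = x :: t \/ sfx s t.
Proof. by move=> [[|y u] /= E]; [left|right; exists u; case: E]. Qed.
Lemma sfx_strict s t : sfx s t -> s <> t -> exists x, sfx (x :: s) t.
Proof.
move=> [u ->]; case/lastP: u => [//|u x] _.
by exists x; exists u; rewrite cat_rcons.
Qed.

Lemma sfx_cons_inj x y s t : sfx (x :: s) t -> sfx (y :: s) t -> x = y.
Proof.
move=> [u ->] [v] /(congr1 rev).
rewrite !rev_cat !rev_cons -!cats1 -!catA => /eqP.
by rewrite eqseq_cat // eqxx /= eqseq_cons => /andP[/eqP].
Qed.

(* Finite sequences are represented by lists in reverse order, so initial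
   segments are suffixes of lists. *)
Fixpoint code (s : seq V) : V :=
  if s is x :: s' then rcons_seq (code s') (size s') x else vempty.

Lemma code_consE x s :
  elts (code (x :: s)) = elts (code s) `|` [set kpair (num (size s)) x].
Proof. by rewrite /= vsetK //; apply: smallU; [exact: small_elts|exact: small1]. Qed.

Lemma size_prefix a n : size (prefix a n) = n.
Proof. by elim: n => //= n ->. Qed.

Lemma mem_code_prefix a n : elts (code (prefix a n)) =
  [set e | exists i, (i < n)%N /\ e = kpair (num i) (a i)].
Proof.
elim: n => [|n IH]; first by rewrite elts_vempty; apply/seteqP; split=> // e [i []].
rewrite [prefix _ _]/= code_consE IH size_prefix; apply/seteqP; split=> e.
  by move=> [[i [ni ->]]|->]; [exists i|exists n]; rewrite ltnS ?leqnn // ltnW.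
move=> [i [+ ->]]; rewrite ltnS leq_eqVlt => /orP[/eqP ->|ni]; first by right.
by left; exists i.
Qed.

Lemma eq_prefix a b n : (forall i, (i < n)%N -> a i = b i) -> prefix a n = prefix b n.
Proof.
elim: n => //= n IH ab; rewrite ab // IH // => i ni; apply: ab; exact: ltnW.
Qed.

Lemma list_prefix s : s = prefix (nth vempty (rev s)) (size s).
Proof.
elim: s => //= x s IH; congr cons.
  by rewrite rev_cons nth_rcons size_rev ltnn eqxx.
rewrite {1}IH; apply: eq_prefix => i si.
by rewrite rev_cons nth_rcons size_rev si.
Qed.

Lemma code_sub s t : code s ⊆ code t <-> sfx s t.
Proof.
split=> [|[u ->]]; last first.
  by elim: u => //= x u IH e /IH; rewrite -/(code (x :: _)) code_consE; left.
rewrite (list_prefix s) (list_prefix t) !mem_code_prefix => st.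
have {}st i : (i < size s)%N -> (i < size t)%N /\
    nth vempty (rev s) i = nth vempty (rev t) i.
  move=> si; have [|j [jt /kpair_inj[/num_inj -> ->]]//] :=
    st (kpair (num i) (nth vempty (rev s) i)); by exists i.
(* These are the entries of t after the first [size s] ones, put back in reverse order. *)
exists (rev (drop (size s) (rev t))).
rewrite -!list_prefix -{1}[t]revK -{1}(cat_take_drop (size s) (rev t)) rev_cat.
congr cat; rewrite -[RHS]revK; congr rev.
have stz : (size s <= size t)%N.
  by case: (ltnP (size t) (size s)) => // /st[]; rewrite ltnn.
apply: (@eq_from_nth _ vempty).
  by rewrite size_take_min !size_rev; apply/minn_idPl.
move=> i; rewrite size_take_min size_rev leq_min => /andP[si _].
by rewrite nth_take //; have [_ ->] := st i si.
Qed.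

Lemma code_inj s t : code s = code t -> s = t.
Proof.
move=> E; have /code_sub st : code s ⊆ code t by rewrite E.
have /code_sub/sfx_size ts : code t ⊆ code s by rewrite E.
exact: sfx_size_eq.
Qed.

(** * Namba conditions as trees of lists *)

Section NambaTrees.
Variables (k l : V) (I : set (set V)).

Fixpoint node (s : seq V) : Prop :=
  if s is x :: s' then [/\ Pk k l x, forall y, y \in s' -> y ⊆ x & node s'] else True.

Lemma node_sfx s t : sfx s t -> node t -> node s.
Proof. by move=> [u ->]; elim: u => //= x u IH [_ _ us]; exact: IH. Qed.

Lemma mem_prefix a n y : y \in prefix a n <-> exists2 i, (i < n)%N & y = a i.
Proof.
elim: n => [|n IH] /=; first by split=> // -[].
rewrite inE; split=> [/orP[/eqP ->|/IH[i ni yi]]|[i + yi]].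
- by exists n.
- by exists i => //; exact: ltnW.
- rewrite ltnS leq_eqVlt => /orP[/eqP ni|ni]; first by rewrite yi ni eqxx.
  by apply/orP; right; apply/IH; exists i.
Qed.

Lemma node_prefix a n : node (prefix a n) <->
  (forall i, (i < n)%N -> Pk k l (a i)) /\
  (forall i j, (i < j < n)%N -> a i ⊆ a j).
Proof.
elim: n => [|n IH] /=; first by split=> // _; split=> // i j; rewrite ltn0 andbF.
split=> [[Pn sn /IH[h1 h2]]|[h1 h2]]; split.
- by move=> i; rewrite ltnS leq_eqVlt => /orP[/eqP ->|/h1].
- move=> i j /andP[ij]; rewrite ltnS leq_eqVlt => /orP[/eqP jE|jn].
    by rewrite jE in ij *; apply: sn; apply/mem_prefix; exists i.
  by apply: h2; rewrite ij.
- exact: h1.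
- by move=> y /mem_prefix[i ni ->]; apply: h2; rewrite ni /=.
- apply/IH; split=> [i ni|i j /andP[ij jn]]; first by apply: h1; exact: ltnW.
  by apply: h2; rewrite ij; exact: ltnW.
Qed.

Lemma incr_seqP n c : incr_seq k l n c <-> exists s, [/\ node s, size s = n & c = code s].
Proof.
split=> [[[c1 c2] c3]|[s [ns <- ->]]].
  have ch i : exists b, (i < n)%N -> kpair (num i) b ∈ c.
    case: (ltnP i n) => [ni|_]; last by exists vempty.
    by have [b [bc _]] := c2 _ (num_mem ni); exists b.
  have [a aP] := choice ch.
  exists (prefix a n); rewrite size_prefix; split=> //.
    apply/node_prefix; split=> [i ni|i j /andP[ij jn]].
      have [x [y [_ Py /kpair_injr ->]]] := c1 _ (aP i ni); exact: Py.
    by apply: (c3 _ _ _ _ (num_mem ij)); apply: aP => //; exact: ltn_trans jn.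
  apply: extensionality; rewrite mem_code_prefix; apply/seteqP; split=> e.
    move=> ec; have [x [y [xn _ E]]] := c1 _ ec; subst e.
    move: xn; rewrite numE => -[i /= ni iE]; subst x; exists i; split=> //.
    congr kpair; have [b [_ bu]] := c2 _ (num_mem ni).
    by rewrite -(bu _ ec) -(bu _ (aP _ ni)).
  by move=> [i [ni ->]]; exact: aP.
move: ns; rewrite (list_prefix s) size_prefix.
set a := nth _ _; set m := size s => /node_prefix[h1 h2].
rewrite /incr_seq /= /funs /= mem_code_prefix; split; first split.
- move=> _ [i [ni ->]]; exists (num i), (a i); split=> //; first exact: num_mem.
  exact: h1.
- move=> x; rewrite numE => -[i /= ni <-]; exists (a i); split; first by exists i.
  by move=> b [j [_ /kpair_inj[/num_inj -> ->]]].
- move=> x y b d xy [i [ni /kpair_inj[xi bi]]] [j [nj /kpair_inj[yj dj]]].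
  by subst; move/mem_num: xy => ij; apply: h2; rewrite ij.
Qed.

(* [p] is a condition with trunk [t]. *)
Record cond (p : V) (t : seq V) : Prop := Cond {
  cond_node : forall c, c ∈ p -> exists2 s, node s & c = code s;
  cond_down : forall s u, code u ∈ p -> sfx s u -> code s ∈ p;
  cond_trunk : code t ∈ p;
  cond_cmp : forall s, code s ∈ p -> sfx s t \/ sfx t s;
  cond_pos : forall s, code s ∈ p -> sfx t s ->
    positive k l I [set x | code (x :: s) ∈ p] }.

Lemma cond_code p t s : cond p t -> code s ∈ p -> node s.
Proof. by move=> [h _ _ _ _] /h[s' ns' /code_inj ->]. Qed.

Lemma small_Pk : small (Pk k l).
Proof. by apply: (small_sub (powerset l)) => a []. Qed.

Lemma small_nodes : small [set c | exists2 s, node s & c = code s].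
Proof.
pose D := [set e | exists a b, [/\ elts omega a, Pk k l b & e = kpair a b]].
have sD : small D by apply: small_image2; [exact: small_elts|exact: small_Pk].
apply: (small_sub (powerset (vset D))) => _ [s ns ->].
rewrite /= vsetK // => e; move: ns; rewrite (list_prefix s) mem_code_prefix.
move=> /node_prefix[h1 _] [i [ni ->]]; exists (num i), (nth vempty (rev s) i).
by split=> //; [rewrite omegaE; exists i|exact: h1].
Qed.

Lemma small_Nm : small (Nm k l I).
Proof.
apply: (small_sub (powerset (vset [set c | exists2 s, node s & c = code s]))).
move=> p [pn _ _] c cp; rewrite vsetK; last exact: small_nodes.
by have [n /incr_seqP[s [ns _ ->]]] := pn _ cp; exists s.
Qed.

Hypothesis pos2 : forall A x, positive k l I A -> exists2 y, A y & y <> x.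

(** Were t' a proper initial segment of t, each successor of t' in q would be a node of p comparable
    with t, hence the next entry of t; but a positive set has a second point. *)
Lemma cond_sub p q t t' : cond p t -> cond q t' -> q ⊆ p -> sfx t t'.
Proof.
move=> cp cq qp; have [t't|//] := cond_cmp cp (qp _ (cond_trunk cq)).
have [->|ne] := pselect (t' = t); first exact: sfx_refl.
have [x xt] := sfx_strict t't ne.
have [y yq yx] := pos2 x (cond_pos cq (cond_trunk cq) (sfx_refl _)).
case: yx; have [yt|ty] := cond_cmp cp (qp _ yq); first exact: sfx_cons_inj yt xt.
exact: sfx_cons_inj (sfx_refl _) (sfx_trans xt ty).
Qed.

Lemma cond_uniq p t t' : cond p t -> cond p t' -> t = t'.
Proof.
move=> c c'; apply: (sfx_size_eq (cond_sub c c' (@subset_refl _ _))).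
by apply: sfx_size; exact: cond_sub c' c _.
Qed.

(** Maximality of the trunk comes from [pos2]: if a node s longer than t were comparable with all
    nodes, every successor of t would be the next entry of s. *)
Lemma NmP p : Nm k l I p <-> exists t, cond p t.
Proof.
split=> [[p1 p2 [c [n [/incr_seqP[t [nt tn ->]] tp tc tm] tpos]]]|[t ct]].
  have pn d : d ∈ p -> exists2 s, node s & d = code s.
    by move=> /p1[m /incr_seqP[s [ns _ ->]]]; exists s.
  have pnode s : code s ∈ p -> node s by move=> /pn[s' + /code_inj ->].
  exists t; split=> //.
  - move=> s u up su; apply: (p2 _ (size s) _ up); last exact/code_sub.
    by apply/incr_seqP; exists s; split=> //; apply: node_sfx su (pnode _ up).
  - by move=> s /tc[] /code_sub; auto.
  - move=> s sp ts; apply: (tpos _ (size s)) => //; last exact/code_sub.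
    by apply/incr_seqP; exists s; split=> //; exact: pnode.
have pn := cond_code ct.
split.
- by move=> c /(cond_node ct)[s ns ->]; exists (size s); apply/incr_seqP; exists s.
- move=> c m d cp /incr_seqP[s [ns _ ->]]; have [u nu E] := cond_node ct cp; subst c.
  by move=> /code_sub; exact: (cond_down ct cp).
exists (code t); last first.
  move=> c n cp /incr_seqP[s [ns <- E]]; subst c => /code_sub ts.
  exact: (cond_pos ct).
exists (size t); split.
- by apply/incr_seqP; exists t; split=> //; apply: pn; exact: cond_trunk ct.
- exact: cond_trunk ct.
- move=> c cp; have [s _ E] := cond_node ct cp; subst c.
  by have [] := cond_cmp ct cp => /code_sub; [left|right].
move=> m c /incr_seqP[s [ns <- ->]] sp sc.
have scmp u : code u ∈ p -> sfx u s \/ sfx s u by move=> /sc[] /code_sub; auto.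
have [/sfx_size //|ts] := cond_cmp ct sp.
have [->//|ne] := pselect (t = s).
have [x xs] := sfx_strict ts ne.
have [y yp yx] := pos2 x (cond_pos ct (cond_trunk ct) (sfx_refl _)).
case: yx; have [ys|sy] := scmp _ yp; first exact: sfx_cons_inj ys xs.
exact: sfx_cons_inj (sfx_refl _) (sfx_trans xs sy).
Qed.

Definition restrict (p : V) (s : seq V) : V :=
  vset [set c | c ∈ p /\ (c ⊆ code s \/ code s ⊆ c)].

Lemma restrictE p s :
  elts (restrict p s) = [set c | c ∈ p /\ (c ⊆ code s \/ code s ⊆ c)].
Proof. by rewrite vsetK //; apply: (small_sub (small_elts p)) => c []. Qed.

Lemma mem_restrict p s u :
  code u ∈ restrict p s <-> code u ∈ p /\ (sfx u s \/ sfx s u).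
Proof.
by rewrite restrictE; split=> -[up] [/code_sub|/code_sub]; split; auto.
Qed.

Lemma restrict_sub p s : restrict p s ⊆ p.
Proof. by move=> c; rewrite restrictE => -[]. Qed.

Lemma sfx_total s t u : sfx s u -> sfx t u -> sfx s t \/ sfx t s.
Proof.
elim: u => [|x u IH]; first by move=> [v +] _; case: s; case: v => // _; left; exact: sfx_nil.
move=> /sfx_consE[->|su] /sfx_consE[->|tu]; auto.
- by left; exact: sfx_refl.
- by right; exact: sfx_trans _ (sfx_cons _ _).
- by left; exact: sfx_trans (sfx_cons _ _).
Qed.

Lemma cond_restrict p t s : cond p t -> code s ∈ p -> sfx t s -> cond (restrict p s) s.
Proof.
move=> cp sp ts; split.
- by move=> c /restrict_sub; exact: (cond_node cp).
- move=> u v /mem_restrict[vp vs] uv; apply/mem_restrict; split.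
    exact: (cond_down cp vp uv).
  by case: vs => [/(sfx_trans uv)|/sfx_total/(_ uv)[]]; auto.
- by apply/mem_restrict; split=> //; left; exact: sfx_refl.
- by move=> u /mem_restrict[].
- move=> u /mem_restrict[up _] su.
  have -> : [set x | code (x :: u) ∈ restrict p s] = [set x | code (x :: u) ∈ p].
    apply/seteqP; split=> x; first by move=> /restrict_sub.
    move=> xp; apply/mem_restrict; split=> //; right.
    exact: sfx_trans su (sfx_cons _ _).
  by apply: (cond_pos cp) => //; exact: sfx_trans su.
Qed.

Lemma cond_extend p t n : cond p t -> (size t <= n)%N ->
  exists s, [/\ code s ∈ p, sfx t s & size s = n].
Proof.
move=> cp; elim: n => [|n IH].
  by rewrite leqn0 => /eqP t0; exists t; split=> //; [exact: (cond_trunk cp)|exact: sfx_refl].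
rewrite leq_eqVlt => /orP[/eqP <-|/IH[s [sp ts sn]]].
  by exists t; split=> //; [exact: (cond_trunk cp)|exact: sfx_refl].
have [y yp _] := pos2 vempty (cond_pos cp sp ts).
exists (y :: s); split=> //=; last by rewrite sn.
exact: sfx_trans ts (sfx_cons _ _).
Qed.

End NambaTrees.

(** * Semistationary reflection and null sets *)

Lemma small_funs (A B : set V) : small A -> small B -> small (funs A B).
Proof.
move=> sA sB; apply: (small_sub (powerset (vset
  [set e | exists a b, [/\ A a, B b & e = kpair a b]]))).
by move=> f [fAB _] e ef; rewrite vsetK; [exact: fAB|exact: small_image2].
Qed.

Lemma funs_graph (A B : set V) (f : V -> V) : small A -> (forall x, A x -> B (f x)) ->
  funs A B (vset [set e | exists2 x, A x & e = kpair x (f x)]).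
Proof.
move=> sA fAB.
have sG : small [set e | exists2 x, A x & e = kpair x (f x)].
  apply: (@small_sub _ ((fun x => kpair x (f x)) @` A)); first exact: small_image.
  by move=> _ [x Ax ->]; exists x.
rewrite /funs /= vsetK //; split=> [e [x Ax ->]|x Ax].
  by exists x, (f x); split=> //; exact: fAB.
exists (f x); split; first by exists x.
by move=> y [z _ /kpair_inj[-> ->]].
Qed.

Lemma cexpP a b : elts (cexp a b) #= funs (elts b) (elts a).
Proof. by have [] := cardVP (small_funs (small_elts b) (small_elts a)). Qed.

Lemma card_surj (A B : set V) : A #= B ->
  exists g : V -> V, (forall x, A x -> B (g x)) /\ forall y, B y -> exists2 x, A x & g x = y.
Proof.
move=> /card_set_bijP[g [gAB _ gs]]; exists g; split=> [x /gAB //|y /gs[x Ax xy]].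
by exists x.
Qed.

Lemma vempty_mem k : ordinal k -> elts k !=set0 -> vempty ∈ k.
Proof.
move=> ok [b bk]; by have [//|E|/vset0 []] := ordinal_trichotomy (ordinal_num 0) ok; move: bk; rewrite -E => /vset0.
Qed.

Lemma vempty_omega1 : vempty ∈ omega1.
Proof. have [[o1 _] oo _] := omega1P; apply: vempty_mem => //; by exists omega. Qed.

(** * Positively many points respect a given countable set of functions *)

Section StarLemma.
Variables (k l W : V) (I : set (set V)).
Hypotheses (rk : regular k) (idI : ideal k l I)
  (k_cl : forall a, a ∈ k -> cexp a omega ∈ k) (ssr : SSR W k) (oW : omega1 ⊆ W).

(** [R] is replaced by an equipotent cardinal c in [k]. A countable subset of c is the range of a
    function on [omega], and the number of these functions is below [k] by [k_cl]. *)
Lemma card_ctbl_subsets (R : V) : ~~ (elts k #<= elts R) ->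
  exists2 a, a ∈ k & exists f : V -> set V,
    forall x, ctbl_subsets (elts R) x -> exists2 i, i ∈ a & f i = x.
Proof.
move=> kR; have [ck _ _] := rk.
have [c [ck' _ cR]] := card_lt_cardinal ck (small_elts R) kR.
have [j [jR js]] := card_surj cR.
have [e [_ es]] := card_surj (cexpP c omega).
exists (cexp c omega); first exact: k_cl.
exists (fun i => [set j b | b in [set b | exists n, kpair n b ∈ e i]]) => x cx.
have [xR _] := cx; have [a aE] := ctbl_subsets_range cx.
have pre n : exists b, b ∈ c /\ j b = a n.
  by have [|b] := js (a n); [apply: xR; rewrite aE; exists n|exists b].
have [b bP] := choice pre.
(* [xget] inverts [num], turning the sequence b into a function on the set [omega]. *)
pose f n := b (xget 0%N [set i | num i = n]).
have fn i : f (num i) = b i.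
  by rewrite /f; case: xgetP => [m _ /num_inj -> //|/(_ i)/(_ erefl)].
have sG : small [set e0 | exists2 x, x ∈ omega & e0 = kpair x (f x)].
  apply: (@small_sub _ ((fun x => kpair x (f x)) @` elts omega)).
    exact/small_image/small_elts.
  by move=> _ [y Ay ->]; exists y.
have [|i ia ie] := es (vset [set e0 | exists2 x, x ∈ omega & e0 = kpair x (f x)]).
  apply: funs_graph; first exact: small_elts.
  by move=> y; rewrite omegaE => -[n _ <-]; rewrite fn; have [] := bP n.
exists i => //; rewrite ie vsetK // aE; apply/seteqP; split=> v.
  move=> [y [n [z]]]; rewrite omegaE => -[m _ <-] /kpair_injr -> <-.
  by rewrite fn; have [_ ->] := bP m; exists m.
move=> [n _ <-]; exists (b n); last by have [] := bP n.
by exists (num n), (num n); [rewrite omegaE; exists n|rewrite fn].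
Qed.

Variables (F : V -> V -> V) (A : V -> set V).
Hypothesis Fo : forall w x, w ∈ W -> Pk k l x -> F w x ∈ omega1.

Let good (m : set V) w := [set x | A w x /\ forall v, m v -> m (F v x)].

(* If the [m] for which [good m w] is null formed a stationary set, it would
   reflect to some small [R]; a point of [A w] outside the fewer than [k] many
   null sets [good m w] with [m ⊆ R] yields a contradiction. *)
Lemma good_nonstationary w : positive k l I (A w) ->
  ~ stationary (elts W) [set m | ctbl_subsets (elts W) m /\ I (good m w)].
Proof.
set S := [set m | _] => -[APk IA] [SW Sst].
(* A stationary set is semistationary, each member being its own witness. *)
have [|R [[RW kR] oR _ [_ [_ SRst]]]] := ssr (S := S).
  split=> //; split=> [x [] //|C cC].
  have [x [Sx Cx]] := Sst C cC; exists x; split=> //; split; first exact: SW.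
  by exists x; split.
have [a ak [f fP]] := card_ctbl_subsets kR.
have [Idown Icompl] := (ideal_down idI, ideal_complete idI).
have I0 : I set0.
  have := Icompl vempty (fun=> set0); rewrite elts_vempty bigcup_set0; apply.
    by have [[ok _] /infinite_setN0 k0 _] := rk; exact: vempty_mem.
  by move=> x [].
(* Indices that do not code a set with null [good] are given the empty set, so that completeness
   applies to all of a. *)
pose B i := if pselect (I (good (f i) w)) then good (f i) w else set0.
have IB : I (\bigcup_(i in elts a) B i).
  by apply: Icompl => // i _; rewrite /B; case: pselect.
have [x [Ax xB]] : exists x, A w x /\ ~ (\bigcup_(i in elts a) B i) x.
  apply: contrapT => h; apply: IA; apply: Idown IB _ => x Ax.
  by apply: contrapT => xB; apply: h; exists x.
(* With x fixed, the club consists of the sets closed under v ↦ [F v x]. It meets the reflected set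
   in some m above a y in [S] with the same countable ordinals. For v in y the countable ordinal
   [F v x] is in m, hence in y, so x lies in [good y w], a null set that x was chosen to avoid. *)
have [m [[cm [y [Sy ym yo]]] [_ mO]]] := SRst _ (club_closed_under (elts R) (fun i e =>
  if e is v :: _ then F v x else F vempty x)).
have [/= [cy Iy] cyR] := Sy.
have [i ia iE] := fP _ cyR.
apply: xB; exists i => //; rewrite /B iE; case: pselect => //= _; split=> // v yv.
have vW : v ∈ W by apply: cy.1.
have Fvx : F v x ∈ omega1 by apply: Fo => //; exact: APk.
have mF : m (F v x).
  have := mO 0%N [:: v]; apply; last exact: oR.
  by move=> u; rewrite inE => /eqP ->; exact: ym.
have : (m `&` elts omega1) (F v x) by [].
by rewrite -yo => -[].
Qed.

(** A diagonal intersection: for each w, Kueker's functions of a club avoiding the exceptional sets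
    take w as an additional first argument, so a set N closed under [O] is treated for all its
    elements w at once. *)
Lemma star_lemma : exists O : nat -> seq V -> V,
  (forall i e, lsub e (elts W) -> O i e ∈ W) /\
  forall N, N !=set0 -> countable N -> N `<=` elts W ->
    (forall i e, lsub e N -> N (O i e)) ->
    forall w, N w -> positive k l I (A w) ->
      positive k l I [set x | A w x /\ forall v, N v -> N (F v x)].
Proof.
have iW : infinite_set (elts W).
  move=> /finite_set_countable cW; apply: uncountable_omega1.
  by apply: sub_countable cW; exact: subset_card_le.
have o0 : vempty ∈ W.
  apply: oW; have [[[o1 _] _] oo _] := omega1P.
  by apply: (o1 _ oo); rewrite omegaE; exists 0%N.
have Gw w : exists G : seq V -> nat -> V, (forall e i, lsub e (elts W) -> G e i ∈ W) /\
    forall N, N !=set0 -> countable N -> N `<=` elts W ->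
    (forall e i, lsub e N -> N (G e i)) -> positive k l I (A w) ->
      ~ I (good N w).
  have [Aw|nAw] := pselect (positive k l I (A w)); last first.
    by exists (fun _ _ => vempty); split=> // N _ _ _ _ /nAw.
  have := good_nonstationary Aw; set S := [set m | _] => nst.
  have [C cC CS] : exists2 C, club (elts W) C & S `&` C = set0.
    apply: contrapT => h; apply: nst; split=> [m [] //|C cC].
    by apply/set0P/eqP => SC; apply: h; exists C.
  have [G [GW GP]] := club_kueker_closed iW cC; exists G; split=> // N N0 cN NW NG _ IN.
  have CN := GP _ N0 cN NW NG.
  have [CW _ _] := cC.
  have SCN : (S `&` C) N by split=> //; split=> //; exact: CW.
  by rewrite CS in SCN.
have [G GP] := choice Gw.
exists (fun i e => if e is w :: e' then G w e' i else vempty); split.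
  move=> i [|w e] // /lsub_cons[_ eW]; exact: (GP w).1.
move=> N N0 cN NW NO w Nw Aw; split; first by case: Aw => APk _ x [/APk].
apply: (GP w).2 => // e i eN; exact: (NO i (w :: e)) ((lsub_cons _ _ _).2 (conj Nw eN)).
Qed.

End StarLemma.

Lemma succ_mem k c : regular k -> c ∈ k -> succ c ∈ k.
Proof.
move=> rk ck; have [cardk ik _] := rk; have oc := ordinal_elt cardk.1 ck.
apply: cardinal_gt => //.
  apply: ordinalP => y; rewrite !succE => -[yc|->].
  - by move=> z zy; left; exact: oc.1 zy.
  - by move=> z zc; left.
  - exact: ordinal_elt yc.
  - exact: oc.
rewrite succE; apply: regular_setU => //; first exact: small_elts.
- exact: small1.
- exact: cardk.2.
- by apply/negP => /card_le_finite h; apply: ik; apply: h; exact: finite_set1.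
Qed.

(** * Coding functions on [Pk k l] and subsets of it by elements of [W] *)

Section Enumerations.
Variables (k l : V).
Hypotheses (rk : regular k) (o1l : omega1 ⊆ l).

Local Notation Z := (\bigcup_(c in elts k) funs (elts c) (elts l)).
Local Notation W := (cexp (num 2) (cexp_lt l k)).

Lemma small_Z : small Z.
Proof.
apply: small_bigcup; first exact: small_elts.
by move=> c _; apply: small_funs; exact: small_elts.
Qed.

(** The pair (x, a) becomes an enumeration of x of some length c in [k], with a appended at place c.
    The domain gives back c, the values below c give x, and the last value gives a. *)
Lemma Pk_code : exists j : V -> V -> V,
  (forall x a, Pk k l x -> a ∈ l -> Z (j x a)) /\
  (forall x a y b, Pk k l x -> Pk k l y -> j x a = j y b -> x = y /\ a = b).
Proof.
have ch x : exists p : V * (V -> V), Pk k l x -> [/\ p.1 ∈ k,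
    forall i, i ∈ p.1 -> p.2 i ∈ x & forall y, y ∈ x -> exists2 i, i ∈ p.1 & p.2 i = y].
  have [[xl kx]|nx] := pselect (Pk k l x); last by exists (vempty, id).
  have [ck _ _] := rk.
  have [c [ck' _ /card_surj[g [gc gs]]]] := card_lt_cardinal ck (small_elts x) kx.
  by exists (c, g).
have [p pP] := choice ch; pose c x := (p x).1; pose g x := (p x).2.
pose h x a := fun i => if pselect (i = c x) then a else g x i.
pose gr x a := [set e | exists2 i, i ∈ succ (c x) & e = kpair i (h x a i)].
have sgr x a : small (gr x a).
  apply: (@small_sub _ ((fun i => kpair i (h x a i)) @` elts (succ (c x)))).
    exact/small_image/small_elts.
  by move=> _ [y Ay ->]; exists y.
have grE x a : elts (vset (gr x a)) = gr x a by rewrite vsetK.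
exists (fun x a => vset (gr x a)); split.
  move=> x a Px al; have [ck gx _] := pP x Px; exists (succ (c x)); first exact: succ_mem.
  apply: funs_graph; first exact: small_elts.
  move=> i; rewrite succE /h => -[ic|->]; case: pselect => //= ?.
  by apply: Px.1; exact: gx.
have sub x a y b : Pk k l x -> Pk k l y -> vset (gr x a) = vset (gr y b) -> c x ∈ succ (c y).
  move=> Px Py /(congr1 elts); rewrite !grE => E.
  have : gr x a (kpair (c x) (h x a (c x))).
    by exists (c x) => //; rewrite succE; right.
  by rewrite E => -[i ic /kpair_injl ->].
move=> x a y b Px Py E.
have cxy : c x = c y.
  have := sub _ _ _ _ Px Py E; have := sub _ _ _ _ Py Px (esym E).
  rewrite !succE => -[yx|//] [xy|//]; by case: (mem_asym xy).
move: E => /(congr1 elts); rewrite !grE => E.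
have hxy i : i ∈ succ (c x) -> h x a i = h y b i.
  move=> ic; have : gr x a (kpair i (h x a i)) by exists i.
  by rewrite E => -[i' _ /kpair_inj[-> ->]].
have [_ gx gxs] := pP x Px; have [_ gy gys] := pP y Py.
have gE i : i ∈ c x -> g x i = g y i.
  move=> ic; have := hxy i; rewrite succE /h -cxy; case: pselect => [ie|?] /=.
    by rewrite ie in ic; case: (mem_irr ic).
  by apply; left.
split; last first.
  have := hxy (c x); rewrite succE /h; case: pselect => [?|[]] //=.
  case: pselect => [?|n] /=; first by apply; right.
  by case: (n cxy).
apply: extensionality; apply/seteqP; split=> v.
  by move=> /gxs[i ic <-]; rewrite -/(g x i) gE //; apply: gy; rewrite -/(c y) -cxy.
move=> /gys[i]; rewrite -/(c y) -cxy => ic <-; rewrite -/(g y i) -gE //; exact: gx.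
Qed.

Lemma W_subsets : exists D : V -> set V,
  forall B, B `<=` Z -> exists2 w, w ∈ W & forall z, Z z -> (D w z <-> B z).
Proof.
have [_ /card_surj[e [eZ es]]] := cardVP small_Z.
have [d [_ ds]] := card_surj (cexpP (num 2) (cexp_lt l k)).
(* A right inverse of e: subsets of Z become characteristic functions on the cardinal
   [cexp_lt l k]. *)
pose e' := fun z => xget vempty [set y | y ∈ cexp_lt l k /\ e y = z].
have e'P z : Z z -> e' z ∈ cexp_lt l k /\ e (e' z) = z.
  move=> /es[y yk ye]; rewrite /e'; case: xgetP => [//|/(_ y)[]] //.
exists (fun w z => kpair (e' z) (num 1) ∈ d w) => B BZ.
pose f y := if pselect (B (e y)) then num 1 else num 0.
have [|w wW wE] := ds (vset [set p | exists2 y, y ∈ cexp_lt l k & p = kpair y (f y)]).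
  apply: funs_graph; first exact: small_elts.
  by move=> y _; rewrite /f; case: pselect => ?; [exact: (@num_mem 1 2)|exact: (@num_mem 0 2)].
have sG : small [set p | exists2 y, y ∈ cexp_lt l k & p = kpair y (f y)].
  apply: (@small_sub _ ((fun y => kpair y (f y)) @` elts (cexp_lt l k))).
    exact/small_image/small_elts.
  by move=> _ [y Ay ->]; exists y.
exists w => // z Zz; have [zk ez] := e'P z Zz; rewrite wE vsetK //; split.
  move=> [y yk /kpair_inj[<-]]; rewrite /f ez; case: pselect => // _ /num_inj //.
move=> Bz; exists (e' z) => //; rewrite /f ez; by case: pselect.
Qed.

(** A function is coded by its graph, a set B by the pairs (x, [vempty]) with x in B. A code without
    a value at x is read as [vempty], which keeps all values of F in omega1. *)
Lemma W_enumerations : exists (F : V -> V -> V) (A : V -> set V),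
  [/\ forall w x, w ∈ W -> Pk k l x -> F w x ∈ omega1,
      forall f, (forall x, Pk k l x -> f x ∈ omega1) ->
        exists2 w, w ∈ W & forall x, Pk k l x -> F w x = f x
    & forall B, B `<=` Pk k l -> exists2 w, w ∈ W & A w = B].
Proof.
have [j [jZ ji]] := Pk_code; have [D DP] := W_subsets.
have l0' : vempty ∈ l by apply: o1l; exact: vempty_omega1.
exists (fun w x => xget vempty [set a | a ∈ omega1 /\ D w (j x a)]).
exists (fun w => [set x | Pk k l x /\ D w (j x vempty)]); split.
- by move=> w x _ _; case: xgetP => [a _ []//|_]; exact: vempty_omega1.
- move=> f fo; have [|w wW wD] := DP [set z | exists2 x, Pk k l x & z = j x (f x)].
    by move=> _ [x Px ->]; apply: jZ => //; exact/o1l/fo.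
  exists w => // x Px; case: xgetP => [a _ [ao /wD h]|/(_ (f x))[]].
    have [y Py /ji[]//] := h (jZ _ _ Px (o1l ao)); by move=> -> ->.
  split; first exact: fo.
  by apply/wD; [apply: jZ => //; exact/o1l/fo|exists x].
- move=> B BP; have [|w wW wD] := DP [set z | exists2 x, B x & z = j x vempty].
    by move=> _ [x Bx ->]; apply: jZ => //; exact: BP.
  exists w => //; apply/seteqP; split=> x.
    move=> [Px /wD]; case; first exact: jZ.
    by move=> y By /ji[||-> _] //; exact: BP.
  move=> Bx; split; first exact: BP.
  by apply/wD; [apply: jZ => //; exact: BP|exists x].
Qed.

(** The singletons of the codes of ([vempty], a), for a in omega1, are distinct subsets of Z, so
    omega1 injects into the cardinal W. *)
Lemma omega1_W : omega1 ⊆ W.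
Proof.
have [j [jZ ji]] := Pk_code; have [D DP] := W_subsets.
have P0 : Pk k l vempty.
  split; first by rewrite elts_vempty.
  by apply/negP; rewrite elts_vempty => /card_le_finite h; case: rk => _ + _; apply; exact: h.
have [cW _] := cardVP (small_funs (small_elts (cexp_lt l k)) (small_elts (num 2))).
have [co1 _ _] := omega1P.
apply: cardinal_le_sub => //; first by case: cW.
have ch a : exists w, a ∈ omega1 -> w ∈ W /\
    forall z, Z z -> (D w z <-> z = j vempty a).
  have [ao|] := pselect (a ∈ omega1); last by exists a.
  have [|w wW wD] := DP [set j vempty a]; last by exists w.
  by move=> _ ->; apply: jZ => //; exact: o1l.
have [f fP] := choice ch.
apply/card_leVP; exists f; split=> [a /fP[]//|a b ao bo E].
have [_ ha] := fP a ao; have [_ hb] := fP b bo.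
have Za : Z (j vempty a) by apply: jZ => //; exact: o1l.
by have [] := ji _ _ _ _ P0 P0 ((hb _ Za).1 (eq_ind _ (fun w => D w _) ((ha _ Za).2 erefl) _ E)).
Qed.

End Enumerations.

(** * From reflection to semiproperness *)

Section FineIdeal.
Variables (k l : V) (I : set (set V)).
Hypotheses (rk : regular k) (kl : k ⊆ l) (idI : ideal k l I) (fI : fine k l I).

Lemma ideal0 : I set0.
Proof.
have := ideal_complete idI (a := vempty) (F := fun=> set0).
rewrite elts_vempty bigcup_set0; apply; last by move=> x [].
by have [[ok _] /infinite_setN0 k0 _] := rk; exact: vempty_mem.
Qed.

Lemma positive_sub A B : positive k l I A -> A `<=` B -> B `<=` Pk k l ->
  positive k l I B.
Proof. by move=> [_ IA] AB Bk; split=> // /(ideal_down idI)/(_ AB). Qed.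

(** If A had only the point x, some a in [l] would be missing from x because x has size below [k],
    and by fineness the set of points omitting a, which contains A, is null. *)
Lemma positive2 A x : positive k l I A -> exists2 y, A y & y <> x.
Proof.
move=> [APk IA]; apply: contrapT => h.
have Ax y : A y -> y = x by move=> Ay; apply: contrapT => yx; apply: h; exists y.
have [y Ay] : A !=set0.
  by apply: contrapT => A0; apply: IA; have -> : A = set0;
    [apply/seteqP; split=> // y Ay; apply: A0; exists y|exact: ideal0].
have xE := Ax y Ay; subst y; have [xl kx] := APk _ Ay.
have [a al ax] : exists2 a, a ∈ l & ~ a ∈ x.
  apply: contrapT => nx; move/negP: kx; apply; apply: subset_card_le => a /kl al.
  by apply: contrapT => ax; apply: nx; exists a.
apply: IA; apply: (ideal_down idI) (fI al) _ => y /[dup] Ay' /Ax ->.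
by split=> //; exact: APk.
Qed.

End FineIdeal.

(** * Functions on nodes, and the operations that define the club *)

Section SemiproperNamba.
Variables (k l W : V) (I : set (set V)).
Hypotheses (rk : regular k) (kl : k ⊆ l) (idI : ideal k l I) (fI : fine k l I).
Variables (F : V -> V -> V) (A : V -> set V) (O : nat -> seq V -> V).
Hypotheses (oW : omega1 ⊆ W)
  (F_surj : forall f, (forall x, Pk k l x -> f x ∈ omega1) ->
     exists2 w, w ∈ W & forall x, Pk k l x -> F w x = f x)
  (A_surj : forall B, B `<=` Pk k l -> exists2 w, w ∈ W & A w = B)
  (O_W : forall i e, lsub e (elts W) -> O i e ∈ W)
  (O_star : forall N, N !=set0 -> countable N -> N `<=` elts W ->
    (forall i e, lsub e N -> N (O i e)) ->
    forall w, N w -> positive k l I (A w) ->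
      positive k l I [set x | A w x /\ forall v, N v -> N (F v x)]).

Local Notation P := (Nm k l I).
Local Notation feq := (forces_eq P (fun q p => q ⊆ p)).
Local Notation chk := (check P).
Local Notation cnd := (cond k l I).

Let pos2 := positive2 rk kl idI fI.
Let sP : small P := @small_Nm k l I.

(** Values outside this set are replaced by [vempty], so all graphs of functions on nodes form one
    set, which serves to bound theta. *)
Definition guarded : set V := elts W `|` P `|` elts omega1.
Definition graph (f : seq V -> V) : V := vset [set e | exists2 s, node k l s &
  e = kpair (code s) (if pselect (guarded (f s)) then f s else vempty)].
Definition app (g : V) (s : seq V) : V := xget vempty [set y | kpair (code s) y ∈ g].
Definition appW (g : V) (s : seq V) : V :=
  if pselect (app g s ∈ W) then app g s else vempty.
Definition app1 (g : V) (s : seq V) : V :=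
  if pselect (app g s ∈ omega1) then app g s else vempty.

Definition trunk_of (p : V) : seq V := xget [::] [set t | cnd p t].
Definition decides (t p a : V) := a ∈ omega1 /\ feq p t (chk a).
(** The trunk s is kept, so this is a direct extension; p itself is returned when no direct
    extension decides t. *)
Definition decide (t : V) (s : seq V) (p : V) : V :=
  xget p [set r | [/\ cnd r s, r ⊆ p & exists a, decides t r a]].
Definition decided (t p : V) : V := xget vempty [set a | decides t p a].
Definition idxA (B : set V) : V := xget vempty [set w | w ∈ W /\ A w = B].
Definition idxF (f : V -> V) : V :=
  xget vempty [set w | w ∈ W /\ forall x, Pk k l x -> F w x = f x].

(** Operations 0 and 1 build the trees attached to nodes, 2 reads off decided values, 3 and 4 give
    indices in [W] of successor sets and of the functions x ↦ g(x :: s), 5 evaluates at the trunk, 6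
    gives check names, and from 7 on [O] is applied pointwise. *)
Definition namba_op (i : nat) (e : seq V) : V :=
  match i with
  | 0 => if e is [:: p] then graph (fun=> p) else vempty
  | 1 => if e is [:: t; f] then
           graph (fun s => decide t s (restrict (app f (behead s)) s)) else vempty
  | 2 => if e is [:: t; f] then graph (fun s => decided t (app f s)) else vempty
  | 3 => if e is [:: f] then
           graph (fun s => idxA [set x | code (x :: s) ∈ app f s]) else vempty
  | 4 => if e is [:: g] then
           graph (fun s => idxF (fun x => app1 g (x :: s))) else vempty
  | 5 => if e is [:: g; p] then app1 g (trunk_of p) else vempty
  | 6 => if e is [:: a] then chk a else vempty
  | i'.+3.+4 => graph (fun s => O i' [seq appW g s | g <- e])
  end.

Definition graphs : set V := [set g | forall e, e ∈ g ->
  exists c y, [/\ exists2 s, node k l s & c = code s, guarded y & e = kpair c y]].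

Lemma guarded0 : guarded vempty. Proof. by right; exact: vempty_omega1. Qed.

Lemma small_guarded : small guarded.
Proof. by apply: smallU; [apply: smallU|]; try exact: small_elts. Qed.

Lemma small_graphs : small graphs.
Proof.
apply: (small_sub (powerset (vset [set e | exists c y,
  [/\ exists2 s, node k l s & c = code s, guarded y & e = kpair c y]]))).
move=> g gg e /gg; rewrite vsetK //.
apply: small_image2; [exact: small_nodes|exact: small_guarded].
Qed.

Lemma graphE f : elts (graph f) = [set e | exists2 s, node k l s &
  e = kpair (code s) (if pselect (guarded (f s)) then f s else vempty)].
Proof.
rewrite vsetK //; apply: (small_sub (small_image2 kpair (small_nodes k l) small_guarded)).
move=> _ [s ns ->]; exists (code s); eexists; split=> //; first by exists s.
by case: pselect => //= ?; exact: guarded0.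
Qed.

Lemma graph_in f : graphs (graph f).
Proof.
move=> e; rewrite graphE => -[s ns ->]; exists (code s); eexists; split=> //.
  by exists s.
by case: pselect => //= ?; exact: guarded0.
Qed.

Lemma app_graph f s : node k l s -> guarded (f s) -> app (graph f) s = f s.
Proof.
move=> ns gf; rewrite /app; case: xgetP => [y _|/(_ (f s))[]].
  by rewrite /= graphE => -[s' _ /kpair_inj[/code_inj <- ->]]; case: pselect.
by rewrite /= graphE; exists s => //; case: pselect.
Qed.

Lemma app1_mem g s : app1 g s ∈ omega1.
Proof. by rewrite /app1; case: pselect => //= ?; exact: vempty_omega1. Qed.

Lemma appW_mem g s : appW g s ∈ W.
Proof. by rewrite /appW; case: pselect => //= ?; apply/oW/vempty_omega1. Qed.

Lemma trunk_ofE p t : cnd p t -> trunk_of p = t.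
Proof.
move=> ct; rewrite /trunk_of; case: xgetP => [t' _ ct'|/(_ t) //].
exact: (cond_uniq pos2 ct' ct).
Qed.

(** * The semigeneric tree below a condition of [M] *)

Section GenericCondition.
Variables (H M : set V) (p : V) (t0 : seq V).
Hypotheses (H_graphs : graphs `<=` H) (H_o1 : elts omega1 `<=` H)
  (H_chk : forall a, a ∈ omega1 -> H (chk a)).
Hypotheses (cM : countable M) (M_closed : closed_under H namba_op M).
Hypotheses (Mp : M p) (cp : cnd p t0).

Lemma M_graph i e f : lsub e M -> namba_op i e = graph f -> M (graph f).
Proof. by move=> eM E; rewrite -E; apply: M_closed => //; rewrite E; apply/H_graphs/graph_in. Qed.

Lemma lsub1 a : M a -> lsub [:: a] M.
Proof. by move=> Ma; apply/lsub_cons; split. Qed.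

Lemma lsub2 a b : M a -> M b -> lsub [:: a; b] M.
Proof. by move=> Ma Mb; apply/lsub_cons; split=> //; exact: lsub1. Qed.

Lemma M_vempty : M vempty.
Proof. by apply: (M_closed (i := 0%N) (l := [::])) => //=; apply/H_o1/vempty_omega1. Qed.

Lemma recurrent_enum : exists a : nat -> V, (forall n, M (a n)) /\
  forall t N, M t -> exists2 n, (N <= n)%N & a n = t.
Proof.
have [a aE] := countable_range (ex_intro _ p Mp) cM.
(* The exponent of 2 in n takes each value i at 2^i (2N+1), hence beyond every bound N. *)
exists (fun n => a (logn 2 n)); split=> [n|t N]; first by rewrite aE; exists (logn 2 n).
rewrite {1}aE => -[i _ <-]; exists (2 ^ i * (N.*2).+1)%N.
  apply: (@leq_trans (N.*2).+1); last by rewrite leq_pmull // expn_gt0.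
  by rewrite -addnn; apply: leqW; exact: leq_addr.
rewrite lognM // ?expn_gt0 // pfactorK // lognE /= dvdn2 /= odd_double /=.
by rewrite addn0.
Qed.

Variable a : nat -> V.
Hypotheses (Ma : forall n, M (a n))
  (a_rec : forall t N, M t -> exists2 n, (N <= n)%N & a n = t).

(* [app (stage n) s] is the tree attached to a node [s] that lies [n] levels
   above the trunk; it decides [a n.-1] whenever a direct extension does. *)
Fixpoint stage (n : nat) : V :=
  if n is n'.+1 then
    graph (fun s => decide (a n') s (restrict (app (stage n') (behead s)) s))
  else graph (fun=> p).

Lemma M_stage n : M (stage n).
Proof.
elim: n => [|n IH]; first exact: (@M_graph 0 [:: p] _ (lsub1 Mp)).
exact: (@M_graph 1 [:: a n; stage n] _ (lsub2 (Ma n) IH)).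
Qed.

(** Semigenericity of a single node: evaluated at s, the functions in [M] yield no countable ordinal
    outside [M]. *)
Definition good (s : seq V) := forall g, M g -> app g s ∈ omega1 -> M (app g s).

(** The trunk is determined by p, which is in [M], and operation 5 evaluates there. *)
Lemma good_trunk : good t0.
Proof.
move=> g Mg go; have := M_closed (i := 5) (l := [:: g; p]) (lsub2 Mg Mp).
rewrite /= (trunk_ofE cp) /app1; case: pselect => //= _; apply; exact: H_o1.
Qed.

Definition tree_at (s : seq V) : V := app (stage (size s - size t0)) s.

Inductive kept : seq V -> Prop :=
| kept_trunk : kept t0
| kept_cons x s : kept s -> code (x :: s) ∈ tree_at s -> good (x :: s) -> kept (x :: s).

Lemma decideP t s r : cnd r s -> cnd (decide t s r) s /\ decide t s r ⊆ r.
Proof. by move=> cr; rewrite /decide; case: xgetP => [r' _ [c1 c2 _]|_]; split. Qed.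

Lemma P_cond r s : cnd r s -> P r.
Proof. by move=> cr; apply/(NmP pos2); exists s. Qed.

Lemma keptP s : kept s -> [/\ good s, cnd (tree_at s) s, tree_at s ⊆ p & sfx t0 s].
Proof.
elim=> [|x {}s ks [gs cs sp ts] xs gxs].
  rewrite /tree_at subnn /= app_graph; last by left; right; exact: P_cond cp.
    by split=> //; [exact: good_trunk|exact: sfx_refl].
  exact: cond_code cp (cond_trunk cp).
have csx : cnd (restrict (tree_at s) (x :: s)) (x :: s).
  by apply: (cond_restrict cs) => //; exact: sfx_cons.
have [cd dr] := decideP (a (size s - size t0)) csx.
have E : tree_at (x :: s) =
    decide (a (size s - size t0)) (x :: s) (restrict (tree_at s) (x :: s)).
  rewrite /tree_at /= subSn ?(sfx_size ts) //= app_graph //=.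
    exact: cond_code cs xs.
  by left; right; exact: P_cond cd.
split=> //; rewrite ?E //.
  by move=> c /dr/restrict_sub/sp.
exact: sfx_trans ts (sfx_cons _ _).
Qed.

Lemma kept_consE x s : kept (x :: s) -> sfx t0 s ->
  kept s /\ code (x :: s) ∈ tree_at s.
Proof.
move=> kxs ts; suff : forall u, kept u -> u = x :: s ->
  kept s /\ code (x :: s) ∈ tree_at s by move=> /(_ _ kxs erefl).
move=> u [E|y v kv yv _ [yx vs]].
  by move/sfx_size: ts; rewrite E /= ltnn.
by subst.
Qed.

Lemma tree_at_cons x s : kept (x :: s) -> sfx t0 s -> tree_at (x :: s) =
  decide (a (size s - size t0)) (x :: s) (restrict (tree_at s) (x :: s)) /\
  cnd (restrict (tree_at s) (x :: s)) (x :: s).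
Proof.
move=> kxs ts; have [ks xs] := kept_consE kxs ts; have [gs cs sp _] := keptP ks.
have csx : cnd (restrict (tree_at s) (x :: s)) (x :: s).
  by apply: (cond_restrict cs) => //; exact: sfx_cons.
have [cd dr] := decideP (a (size s - size t0)) csx.
split=> //; rewrite /tree_at /= subSn ?(sfx_size ts) //= app_graph //=.
  exact: cond_code cs xs.
by left; right; exact: P_cond cd.
Qed.

Lemma kept_sfx s u : kept u -> sfx s u -> sfx t0 s -> kept s.
Proof.
elim=> [|x v kv IH xv gx] su ts; first by rewrite (sfx_antisym su ts); exact: kept_trunk.
have [->|sv] := sfx_consE su; first exact: kept_cons.
exact: IH.
Qed.

(** Each step upward restricts the preceding tree to the new node and then passes to a direct
    extension. *)
Lemma tree_at_anti s u : kept u -> sfx s u -> sfx t0 s -> tree_at u ⊆ tree_at s.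
Proof.
move=> ku; elim: ku s => [|x v kv IH xv gx] s su ts; first by rewrite (sfx_antisym su ts).
have [->//|sv] := sfx_consE su.
have [-> /(decideP (a (size v - size t0)))[_ dr]] := tree_at_cons (kept_cons kv xv gx) (sfx_trans ts sv).
by move=> c /dr/restrict_sub; exact: IH.
Qed.

Lemma kept_code s u : kept u -> sfx s u -> sfx t0 s -> code u ∈ tree_at s.
Proof.
move=> ku su ts; apply: (tree_at_anti ku su ts).
by have [_ /cond_trunk] := keptP ku.
Qed.

(** N collects the values at s of the functions in [M]. The pointwise operations close N under [O];
    operation 3 puts an index of the successor set into N, and operation 4 an index of x ↦ g(x :: s)
    for each g in [M]. So [O_star] gives positively many successors x at which all these values g(x
    :: s) lie in N. *)
Lemma kept_positive s : kept s -> positive k l I [set x | kept (x :: s)].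
Proof.
move=> ks; have [gs cs sp ts] := keptP ks.
pose N := [set appW g s | g in M].
have NW : N `<=` elts W by move=> _ [g _ <-]; exact: appW_mem.
pose B := [set x | code (x :: s) ∈ tree_at s].
have posB : positive k l I B := cond_pos cs (cond_trunk cs) (sfx_refl _).
have ns : node k l s := cond_code cs (cond_trunk cs).
have NE g : M g -> app g s ∈ W -> N (app g s).
  by move=> Mg gW; exists g => //; rewrite /appW; case: pselect.
have Ngraph i e f : lsub e M -> namba_op i e = graph f -> f s ∈ W -> N (f s).
  move=> eM E fW; have Mf := M_graph eM E.
  by have := NE _ Mf; rewrite app_graph //; [apply|left; left].
have Nclosed i e : lsub e N -> N (O i e).
  move=> eN; have [e' e'M ->] : exists2 e', lsub e' M & e = [seq appW g s | g <- e'].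
    elim: e eN => [|v e IH] /= eN; first by exists [::].
    have /lsub_cons[[g Mg <-] /IH[e' e'M ->]] := eN.
    by exists (g :: e') => //; apply/lsub_cons.
  apply: (Ngraph (7 + i)%N e' (fun s => O i [seq appW g s | g <- e'])) => //.
  by apply: O_W => _ /mapP[g _ ->]; exact: appW_mem.
have idxAP : idxA B ∈ W /\ A (idxA B) = B.
  have [w wW wB] := A_surj posB.1.
  by rewrite /idxA; case: xgetP => [//|/(_ w)[]].
have NA : N (idxA B).
  apply: (Ngraph 3 [:: stage (size s - size t0)]
    (fun s' => idxA [set x | code (x :: s') ∈ app (stage (size s - size t0)) s'])) => //.
    exact/lsub1/M_stage.
  exact: idxAP.1.
have idxFP g : idxF (fun x => app1 g (x :: s)) ∈ W /\
    forall x, Pk k l x -> F (idxF (fun x => app1 g (x :: s))) x = app1 g (x :: s).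
  have [|w wW wF] := F_surj (f := fun x => app1 g (x :: s)).
    by move=> x _; exact: app1_mem.
  by rewrite /idxF; case: xgetP => [//|/(_ w)[]].
have NF g : M g -> N (idxF (fun x => app1 g (x :: s))).
  move=> Mg; apply: (Ngraph 4 [:: g] (fun s => idxF (fun x => app1 g (x :: s)))) => //.
    exact: lsub1.
  by have [] := idxFP g.
have cN : countable N by apply: card_le_trans (card_image_le _ _) cM.
have N0 : N !=set0 by exists (idxA B).
have := O_star N0 cN NW Nclosed NA; rewrite idxAP.2 => /(_ posB) pos.
apply: (positive_sub idI pos) => x.
  move=> [Bx Nx]; apply: kept_cons => // g Mg go.
  have [_ ng] : node k l s /\ node k l (x :: s) by split=> //; exact: cond_code cs Bx.
  have := Nx _ (NF g Mg); rewrite (idxFP g).2; last by case: ng.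
  (* The countable ordinal g(x :: s) is the value at s of some g' in [M], so goodness of s puts it
     in [M]. *)
  rewrite /app1; case: pselect => //= _ [g' Mg' E]; rewrite -E.
  have : appW g' s ∈ omega1 by rewrite E.
  by rewrite /appW; case: pselect => /= [_|_ _]; [exact: gs|exact: M_vempty].
move=> kxs; have := kept_code kxs (sfx_cons _ _) ts.
by move=> /(cond_code cs)[].
Qed.

Definition generic_tree : V :=
  vset [set c | exists2 s, kept s \/ sfx s t0 & c = code s].

Lemma kept_node s : kept s \/ sfx s t0 -> node k l s /\ code s ∈ p.
Proof.
have tp := cond_trunk cp; move=> [/keptP[_ cs sp _]|st].
  by have sc := cond_trunk cs; split; [exact: cond_code cs sc|exact: sp].
split; first exact: node_sfx st (cond_code cp tp).
exact: (cond_down cp tp).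
Qed.

Lemma generic_treeE :
  elts generic_tree = [set c | exists2 s, kept s \/ sfx s t0 & c = code s].
Proof.
rewrite vsetK //; apply: (small_sub (small_nodes k l)) => _ [s /kept_node[ns _] ->].
by exists s.
Qed.

Lemma mem_generic_tree s : code s ∈ generic_tree <-> kept s \/ sfx s t0.
Proof.
by rewrite generic_treeE; split=> [[s' ks /code_inj ->]|ks] //; exists s.
Qed.

Lemma generic_tree_sub : generic_tree ⊆ p.
Proof. by move=> c; rewrite generic_treeE => -[s /kept_node[_ sp] ->]. Qed.

Lemma generic_tree_kept s : code s ∈ generic_tree -> sfx t0 s -> kept s.
Proof.
move=> /mem_generic_tree[//|st] ts; rewrite (sfx_antisym st ts); exact: kept_trunk.
Qed.

Lemma generic_tree_cond : cnd generic_tree t0.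
Proof.
have cmp s : code s ∈ generic_tree -> sfx s t0 \/ sfx t0 s.
  by move=> /mem_generic_tree[/keptP[]|]; [right|left].
split=> //.
- by move=> c; rewrite generic_treeE => -[s /kept_node[ns _] ->]; exists s.
- move=> s u /mem_generic_tree ku su; apply/mem_generic_tree.
  case: ku => [ku|ut]; last by right; exact: sfx_trans ut.
  have [_ _ _ tu] := keptP ku.
  have [st|ts] := sfx_total su tu; [by right|left; exact: kept_sfx su ts].
- by apply/mem_generic_tree; left; exact: kept_trunk.
- move=> s /generic_tree_kept sq ts; have pos := kept_positive (sq ts).
  apply: (positive_sub idI pos) => x; first by move=> kx; apply/mem_generic_tree; left.
  by move=> /mem_generic_tree/kept_node[[]].
Qed.

(** If r below the tree decides a name t of [M] as b, then at a node of r where t has been treated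
    the attached tree already decides t, necessarily as b. The function from nodes to decided values
    is in [M], so goodness of the node gives b in [M]. *)
Lemma generic_tree_semigeneric :
  forces_same_omega1 P (fun q p => q ⊆ p) M generic_tree.
Proof.
have lrefl (q : V) : q ⊆ q by [].
have ltrans (q r u : V) : r ⊆ q -> q ⊆ u -> r ⊆ u by move=> h1 h2; exact: subset_trans h2.
apply: forces_same_omega1I => //.
  by move=> b Mb bo; apply: (M_closed (i := 6) (l := [:: b])); [exact: lsub1|exact: H_chk].
move=> t r b Mt Pr rq bo rb; have [tr cr] := (NmP pos2 _).1 Pr.
(* Names recur, so t is treated at a stage n not less than the length of the trunk of r. The node x
   :: s is taken n + 1 levels above t0, where [a n] has just been processed. *)
have [n trn at_] := a_rec (size tr) Mt.
have tt : sfx t0 tr := cond_sub pos2 generic_tree_cond cr rq.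
have [s [sr trs ss]] : exists s, [/\ code s ∈ r, sfx tr s & size s = (size t0 + n).+1].
  by apply: (cond_extend pos2 cr); apply: leqW; apply: leq_trans trn _; exact: leq_addl.
case: s => [//|x s] in sr trs ss *; case: ss => ss.
have ts : sfx t0 (x :: s) := sfx_trans tt trs.
have ts' : sfx t0 s.
  have [E|//] := sfx_consE ts.
  by move: ss => /eqP; rewrite E /= => /eqP h; move: (leq_addr n (size s).+1); rewrite -h ltnn.
have kxs : kept (x :: s) by apply: generic_tree_kept ts; exact: rq.
have [E cR] := tree_at_cons kxs ts'.
have lev : (size s - size t0)%N = n by rewrite ss addKn.
rewrite lev at_ in E.
pose r' := restrict r (x :: s).
have cr' : cnd r' (x :: s) by exact: (cond_restrict cr).
have r'r : r' ⊆ r by exact: restrict_sub.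
(* The nodes of r' above x :: s are kept, hence lie in the tree attached to x :: s, which r'
   therefore extends directly. *)
have r't : r' ⊆ tree_at (x :: s).
  move=> c cr'c; have [u nu uE] := cond_node cr' cr'c; subst c.
  have [gx cx xp tx] := keptP kxs.
  have [ux|xu] := cond_cmp cr' cr'c.
    exact: (cond_down cx (cond_trunk cx)).
  apply: kept_code => //; apply: generic_tree_kept; last exact: sfx_trans xu.
  exact/rq/r'r.
have r'b : feq r' t (chk b) by apply: (forces_eq_mono ltrans) rb.
(* Since r' is itself a deciding direct extension, [decide] did not return its default. *)
have dec : exists c, decides t (tree_at (x :: s)) c.
  rewrite E /decide; case: xgetP => [r1 _ [_ _ //]|/(_ r')[]].
  split=> //; last by exists b.
  apply: subset_trans r't _; rewrite E.
  by have [] := decideP t cR.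
have [dco df] : decides t (tree_at (x :: s)) (decided t (tree_at (x :: s))).
  have [c cd] := dec.
  by rewrite /decided; case: xgetP => [|/(_ c)] //.
have Eb : decided t (tree_at (x :: s)) = b.
  apply: (forces_eq_check sP lrefl (P_cond cr')).
  apply: (forces_eq_trans ltrans) r'b; apply: forces_eq_sym.
  exact: (forces_eq_mono ltrans) r't df.
have [gx cx _ _] := keptP kxs.
pose f s := decided t (app (stage n.+1) s).
have Mf : M (graph f).
  exact: (@M_graph 2 [:: t; stage n.+1] f (lsub2 Mt (M_stage n.+1))).
have lev1 : (size (x :: s) - size t0)%N = n.+1.
  by rewrite [size (x :: s)]/= subSn ?lev // (sfx_size ts').
have treeE : tree_at (x :: s) = app (stage n.+1) (x :: s) by rewrite /tree_at lev1.
have fE : app (graph f) (x :: s) = b.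
  rewrite app_graph /f -?treeE ?Eb //; last by right.
  exact: cond_code cx (cond_trunk cx).
by have := gx _ Mf; rewrite fE; apply.
Qed.

End GenericCondition.

Lemma exists_semigeneric (H M : set V) (p : V) :
  graphs `<=` H -> elts omega1 `<=` H -> (forall a, a ∈ omega1 -> H (chk a)) ->
  countable M -> closed_under H namba_op M -> M p -> P p ->
  exists q, [/\ P q, q ⊆ p & forces_same_omega1 P (fun q p => q ⊆ p) M q].
Proof.
move=> Hg Ho Hc cM Mcl Mp Pp; have [t0 cp] := (NmP pos2 _).1 Pp.
have [a [Ma ar]] := recurrent_enum cM Mp.
exists (generic_tree M p t0 a); split.
- by apply/(NmP pos2); exists t0; exact: (generic_tree_cond Hg Ho cM Mcl Mp cp Ma).
- exact: (generic_tree_sub Ho Mcl Mp cp).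
- exact: (generic_tree_semigeneric Hg Ho Hc cM Mcl Mp cp Ma ar).
Qed.

(** The bound for theta is the size of the transitive closure of U. Above it [Hset theta] contains
    all graphs, countable ordinals and their check names, so closure under [namba_op] really
    captures the results used. *)
Lemma Nm_semiproper_of_star : Nm_semiproper k l I.
Proof.
pose U := graphs `|` elts omega1 `|` chk @` elts omega1.
have sU : small U.
  apply: smallU; last exact/small_image/small_elts.
  by apply: smallU; [exact: small_graphs|exact: small_elts].
have [cc cE] := cardVP (small_trcl (vset U)).
exists (cardV (trcl (vset U))); first by case: cc.
move=> theta rt t0t; have [ct _ _] := rt.
have UH : U `<=` Hset theta.
  apply: (subset_trans _ (@Hset_trcl theta (vset U) _)).
    by move=> x Ux; apply: trcl_elt; rewrite vsetK.
  by apply: (card_lt_elt ct t0t); have/card_eqPle[] := cE.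
exists [set M | ctbl_subsets (Hset theta) M /\ closed_under (Hset theta) namba_op M].
  exact: club_closed_under.
move=> M [cM Mcl]; split=> // p Mp Pp.
have [_ cM' _] := (ctbl_subsetsP _ _).1 cM.
apply: exists_semigeneric Mcl Mp Pp => //.
- by move=> x gx; apply: UH; left; left.
- by move=> x ox; apply: UH; left; right.
- by move=> x ox; apply: UH; right; exists x.
Qed.

End SemiproperNamba.

Lemma semiproper_of_SSR k l I : regular k -> k ⊆ l -> omega1 ∈ k ->
  (forall a, a ∈ k -> cexp a omega ∈ k) -> SSR (cexp (num 2) (cexp_lt l k)) k ->
  ideal k l I -> fine k l I -> Nm_semiproper k l I.
Proof.
move=> rk kl o1k k_cl ssr idI fI.
have o1l : omega1 ⊆ l by move=> a ao; apply: kl; case: rk => -[[tk _] _] _ _; exact: tk ao.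
have oW := omega1_W rk o1l.
have [F [A [Fo Fs As]]] := W_enumerations rk o1l.
have [O [OW Ostar]] := star_lemma rk idI k_cl ssr oW A Fo.
exact: Nm_semiproper_of_star Ostar.
Qed.

(** * From semiproperness to reflection *)

Lemma finite_lt k (A : set V) : regular k -> finite_set A -> ~~ (elts k #<= A).
Proof. by move=> [_ ik _] fA; apply/negP => /card_le_finite h; apply: ik; exact: h. Qed.

Lemma vset_subE (A : set V) x : A `<=` elts x -> elts (vset A) = A.
Proof. by move=> Ax; rewrite vsetK //; apply: (small_sub (small_elts x)). Qed.

(** * The bounded ideal and the full tree *)

Section Jbd.
Variables (k l : V).
Hypothesis rk : regular k.

(** For completeness, the union of fewer than [k] witnesses is a common witness, still of size below
    [k] by regularity. *)
Lemma Jbd_ideal : ideal k l (Jbd k l).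
Proof.
have [ck _ _] := rk; split.
- by move=> A [].
- move=> A B [BP [b Pb hb]] AB; split; first exact: subset_trans BP.
  by exists b => // a /AB; exact: hb.
- move=> a F ak IF; split; first by move=> y [x xa Fx]; have [FP _] := IF x xa; exact: FP.
  have ch x : exists b, x ∈ a -> Pk k l b /\ forall y, F x y -> ~ b ⊆ y.
    by have [/IF[_ [b Pb hb]]|] := pselect (x ∈ a); [exists b|exists x].
  have [b bP] := choice ch.
  have bl : \bigcup_(x in elts a) elts (b x) `<=` elts l.
    by move=> y [x /bP[[xl _] _]]; exact: xl.
  exists (vset (\bigcup_(x in elts a) elts (b x))).
    split; rewrite (vset_subE bl) //; apply: regular_bigcup => //.
    + exact: small_elts.
    + exact: ck.2.
    + by move=> x /bP[[]].
  move=> y [x xa Fx]; rewrite (vset_subE bl) => sub.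
  have [_ /(_ y Fx)] := bP x xa; apply => z zb; apply: sub; by exists x.
- by move=> [_ [b Pb /(_ b Pb)]]; exact.
Qed.

Lemma Jbd_fine : fine k l (Jbd k l).
Proof.
move=> x xl; split; first by move=> a [].
have xE : elts (vset [set x]) = [set x] by rewrite vsetK //; exact: small1.
exists (vset [set x]); first split; rewrite ?xE.
- by move=> _ ->.
- exact/finite_lt/finite_set1.
- by move=> a [_ xa] h; apply: xa; exact: h.
Qed.

Lemma Pk_setU b c : Pk k l b -> Pk k l c ->
  Pk k l (vset (elts b `|` elts c)) /\ elts (vset (elts b `|` elts c)) = elts b `|` elts c.
Proof.
move=> [bl kb] [cl kc]; have E := vset_subE (x := l) (A := elts b `|` elts c).
rewrite /Pk /= E; last by move=> y []; auto.
split=> //; split; first by move=> y []; auto.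
by apply: regular_setU => //; exact: small_elts.
Qed.

Lemma Pk0 : Pk k l vempty.
Proof.
by split; rewrite elts_vempty //; apply: finite_lt => //; exact: finite_set0.
Qed.

Definition full_tree : V := vset [set c | exists2 s, node k l s & c = code s].

Lemma full_treeE : elts full_tree = [set c | exists2 s, node k l s & c = code s].
Proof. by rewrite vsetK //; exact: small_nodes. Qed.

(** Against a proposed bound b, the union of b with a set containing all entries of s is a successor
    of s that includes b. *)
Lemma full_tree_cond : cond k l (Jbd k l) full_tree [::].
Proof.
have fE s : code s ∈ full_tree <-> node k l s.
  by rewrite full_treeE; split=> [[s' ns /code_inj ->]|ns] //; exists s.
split.
- by move=> c; rewrite full_treeE.
- by move=> s u /fE nu su; apply/fE; exact: node_sfx nu.
- exact/fE.
- by move=> s _; right; exact: sfx_nil.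
move=> s /fE ns _; split=> [x /fE[]//|[_ [b Pb hb]]].
have [c Pc sc] : exists2 c, Pk k l c & forall y, y \in s -> y ⊆ c.
  case: {hb} s ns => [_|x s [Px sx _]]; first by exists vempty => //; exact: Pk0.
  by exists x => // y; rewrite inE => /orP[/eqP ->|/sx].
have [Pbc E] := Pk_setU Pb Pc.
apply: (hb (vset (elts b `|` elts c))); last by move=> y yb; rewrite E; left.
by apply/fE; split=> // y /sc yc z /yc zc; rewrite E; right.
Qed.

End Jbd.

Lemma countable_Pk k l (y : set V) : regular k -> omega1 ∈ k -> y `<=` elts l ->
  countable y -> Pk k l (vset y).
Proof.
move=> [ck _ _] ok yl cy; rewrite /Pk /= (vset_subE yl); split=> //.
exact: countable_lt.
Qed.

(** * Hulls of points, names for terms, and the reflection argument *)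

Section Reflection.
Variables (k l : V) (S : set (set V)).
Hypotheses (rk : regular k) (kl : k ⊆ l) (o1k : omega1 ∈ k).
Hypothesis Sl : S `<=` ctbl_subsets (elts l).

(** An ordinal d in [k] that includes omega1 and bounds the trace of x on [k] is added to x; the
    trace of the result on [k] is then d. *)
Lemma Pk_hull x : Pk k l x -> exists R, [/\ Pk k l R, x ⊆ R, omega1 ⊆ R &
  exists2 d, d ∈ k & elts R `&` elts k = elts d].
Proof.
move=> Px; have [xl kx] := Px; have [[ok ck] _ _] := rk.
have [| | |b bk xb] := @regular_bounded k (elts x `&` elts k) id rk.
- by apply: (small_sub (small_elts x)) => y [].
- by apply: contra kx => /card_le_trans; apply; apply: subset_card_le => y [].
- by move=> y [].
have [d dk [bd od]] : exists2 d, d ∈ k & b ⊆ d /\ omega1 ⊆ d.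
  have ob := ordinal_elt ok bk; have oo := ordinal_elt ok o1k.
  have [bo|ob'] := ordinal_total ob oo; first by exists omega1 => //; split.
  by exists b => //; split=> //; exact: ob.1.
have dK : d ⊆ k := ok.1 _ dk.
have Pd : Pk k l d by split; [exact: subset_trans dK kl|exact: ck].
have [PR RE] := Pk_setU rk Px Pd.
exists (vset (elts x `|` elts d)); split=> //; rewrite RE.
- by move=> y yx; left.
- by move=> y /od yd; right.
- exists d => //; apply/seteqP; split=> y; last by move=> yd; split; [right|exact: dK].
  by move=> [[yx|//] yk]; apply: bd; exact: xb.
Qed.

(** G consists of Kueker's functions for a club in the hull of x whose members exclude every y of
    [S]. The set generated from an enumeration of y is in that club, so it has a countable ordinal
    outside y, and that ordinal is a value of G. *)
Lemma not_reflect_witness :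
  ~ (exists R, [/\ Pk k l R, omega1 ⊆ R, exists2 d, d ∈ k & elts R `&` elts k = elts d
     & semistationary (elts R) (S `&` ctbl_subsets (elts R))]) ->
  forall x, Pk k l x -> exists G : seq V -> nat -> V,
    forall b : nat -> V, range b `<=` elts x -> S (range b) ->
      exists n j, G (prefix b n) j ∈ omega1 /\ ~ range b (G (prefix b n) j).
Proof.
move=> nR x /Pk_hull[R [PR xR oR dR]].
have [C cC CS] : exists2 C, club (elts R) C & forall z, C z ->
    ~ exists y, [/\ S y, ctbl_subsets (elts R) y, y `<=` z &
       y `&` elts omega1 = z `&` elts omega1].
  apply: contrapT => h; apply: nR; exists R; split=> //; split; first by move=> y [].
  split=> [z []//|C cC]; apply: contrapT => CS; apply: h; exists C => // z Cz [y [Sy cy yz yo]].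
  apply: CS; exists z; split=> //; split; first by have [CW _ _] := cC; exact: CW.
  by exists y; split.
have iR : infinite_set (elts R).
  move=> /finite_set_countable cR; apply: uncountable_omega1.
  by apply: sub_countable cR; exact: subset_card_le.
have [G [_ GP]] := club_kueker iR cC; exists G => b bx Sb.
have bR : range b `<=` elts R by exact: subset_trans xR.
have [bz Cz] := GP b bR.
apply: contrapT => h; apply: (CS _ Cz); exists (range b); split=> //.
  by have [_ cb] := Sl Sb; split.
apply/seteqP; split=> v [zv vo]; split=> //; first exact: bz.
move: zv => [n [j vE]]; subst v; apply: contrapT => nb; apply: h.
by exists n, j.
Qed.

Local Notation P := (Nm k l (Jbd k l)).
Local Notation feq := (forces_eq P (fun q p => q ⊆ p)).
Local Notation chk := (check P).
Local Notation cnd := (cond k l (Jbd k l)).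

Let pos2 := positive2 rk kl (Jbd_ideal l rk) (Jbd_fine rk).
Let sP : small P := @small_Nm k l (Jbd k l).
Let feq_refl p x : feq p x x.
Proof. by apply: forces_eq_refl => q y. Qed.

Section TermNames.
Variable G : V -> seq V -> nat -> V.

Definition term_value (e : seq V) (j n : nat) (s : seq V) : V :=
  if pselect (G (nth vempty (rev s) n) e j ∈ omega1)
  then G (nth vempty (rev s) n) e j else vempty.

(* A name for the ordinal [G x_n e j], where [x_n] is the n-th entry of the
   generic sequence. *)
Definition term_name (e : seq V) (j n : nat) : V :=
  vset [set c | exists p s a, [/\ cnd p s, (n < size s)%N, a ∈ term_value e j n s
     & c = kpair (chk a) p]].

(** Includes every [term_name], whatever G is; theta can thus be fixed before the names are used. *)
Definition name_pairs : set V :=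
  [set c | exists a p, [/\ (chk @` elts omega1) a, P p & c = kpair a p]].

Lemma small_name_pairs : small name_pairs.
Proof. apply: small_image2 => //; exact/small_image/small_elts. Qed.

Lemma term_value_mem e j n s : term_value e j n s ∈ omega1.
Proof. by rewrite /term_value; case: pselect => //= ?; exact: vempty_omega1. Qed.

Lemma term_name_pairs e j n : [set c | exists p s a, [/\ cnd p s, (n < size s)%N,
  a ∈ term_value e j n s & c = kpair (chk a) p]] `<=` name_pairs.
Proof.
move=> _ [p [s [a [cp _ av ->]]]]; exists (chk a), p; split=> //.
  exists a => //; have [[[o1 _] _] _ _] := omega1P.
  exact: o1 (term_value_mem e j n s) _ av.
by apply/(NmP pos2); exists s.
Qed.

Lemma term_nameE e j n : elts (term_name e j n) =
  [set c | exists p s a, [/\ cnd p s, (n < size s)%N, a ∈ term_value e j n s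
     & c = kpair (chk a) p]].
Proof. by rewrite vsetK //; apply: (small_sub small_name_pairs); exact: term_name_pairs. Qed.

Lemma name_term e j n : name P (term_name e j n).
Proof.
constructor => c; rewrite term_nameE => -[p [s [a [cp _ _ ->]]]].
exists (chk a), p; split=> //; first exact: name_check.
by apply/(NmP pos2); exists s.
Qed.

Lemma term_value_sfx e j n s u : sfx s u -> (n < size s)%N ->
  term_value e j n u = term_value e j n s.
Proof. by move=> [v ->] ns; rewrite /term_value rev_cat nth_cat size_rev ns. Qed.

(** A condition below both r and a condition occurring in the name has a trunk extending both
    trunks, so [term_value] is the same computed from any of the three. *)
Lemma forces_term e j n r s : cnd r s -> (n < size s)%N ->
  feq r (term_name e j n) (chk (term_value e j n s)).
Proof.
move=> cr ns; apply/forces_eqP; split=> z p q.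
  rewrite term_nameE => -[p' [u [a [cp nu av /kpair_inj[-> E]]]]] Pq qr qp.
  subst p'; have [v cq] := (NmP pos2 _).1 Pq.
  exists q, (chk a), q; split=> //.
  apply: check_mem => //.
  rewrite -(term_value_sfx e j (cond_sub pos2 cr cq qr) ns).
  by rewrite (term_value_sfx e j (cond_sub pos2 cp cq qp) nu).
move=> /(mem_check sP)[a av ->] Pq qr _; have [v cq] := (NmP pos2 _).1 Pq.
exists q, (chk a), q; split=> //.
have sv := cond_sub pos2 cr cq qr.
rewrite term_nameE; exists q, v, a; split=> //.
  exact: leq_trans ns (sfx_size sv).
by rewrite (term_value_sfx e j sv ns).
Qed.

End TermNames.

(** E consists of the countable z closed under the values in [l] of Kueker's functions for D; the
    set generated from an enumeration of z adds no element of [l] to z. *)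
Lemma trace_club (H : set V) D : elts l `<=` H -> club H D ->
  exists2 E, club (elts l) E & forall z, E z -> exists M, [/\ D M, z `<=` M &
    M `&` elts l `<=` z].
Proof.
move=> lH cD; have il : infinite_set (elts l).
  by have [_ ik _] := rk; exact: sub_infinite_set kl ik.
have [G [GH GP]] := club_kueker (sub_infinite_set lH il) cD.
exists [set z | ctbl_subsets (elts l) z /\ closed_under (elts l) (fun i e => G e i) z].
  exact: club_closed_under.
move=> z [cz zcl]; have [b bE] := ctbl_subsets_range cz.
have [|bM DM] := GP b; first by rewrite -bE => v /(cz.1)/lH.
exists [set v | exists n j, v = G (prefix b n) j]; split=> //; first by rewrite bE.
by move=> _ [[n [j ->]] vl]; apply: zcl => //; apply: lsub_prefix; rewrite bE.
Qed.

Lemma reflect_of_semiproper : Nm_semiproper k l (Jbd k l) ->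
  semistationary (elts l) S ->
  exists R, [/\ Pk k l R, omega1 ⊆ R, exists2 d, d ∈ k & elts R `&` elts k = elts d
     & semistationary (elts R) (S `&` ctbl_subsets (elts R))].
Proof.
move=> [t0 ot0 semi] [_ [_ Sst]]; apply: contrapT => /not_reflect_witness wit.
have ch x : exists G : seq V -> nat -> V, Pk k l x ->
    forall b : nat -> V, range b `<=` elts x -> S (range b) ->
      exists n j, G (prefix b n) j ∈ omega1 /\ ~ range b (G (prefix b n) j).
  have [/wit[G GP]|] := pselect (Pk k l x); first by exists G.
  by exists (fun _ _ => x).
have [G GP] := choice ch.
pose NS := [set t | elts t `<=` name_pairs].
pose U := NS `|` [set full_tree k l] `|` elts l.
have sU : small U.
  apply: smallU; last exact: small_elts; apply: smallU; last exact: small1.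
  apply: (small_sub (powerset (vset name_pairs))) => t tn.
  by rewrite /= vsetK //; exact: small_name_pairs.
(* theta exceeds t0, so semiproperness applies there, and also the transitive closure of U, so U
   consists of elements of [Hset theta]. *)
have [theta rt] := large_regular (smallU (small_elts t0) (small_trcl (vset U))).
move=> tbig; have [ct _ _] := rt.
have t0t : t0 ∈ theta.
  apply: cardinal_gt => //; apply: contra tbig => /card_le_trans; apply.
  by apply: subset_card_le => x; left.
have UH : U `<=` Hset theta.
  apply: (subset_trans _ (@Hset_trcl theta (vset U) _)).
    by move=> x Ux; apply: trcl_elt; rewrite vsetK.
  apply: contra tbig => /card_le_trans; apply.
  by apply: subset_card_le => x; right.
have [C cC CP] := semi theta rt t0t.
have lH : elts l `<=` Hset theta by move=> x xl; apply: UH; right.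
have il : infinite_set (elts l).
  by have [_ ik _] := rk; exact: sub_infinite_set kl ik.
have [g [gH gP]] := club_kueker_closed (sub_infinite_set lH il) cC.
(* Index 0 gives the full tree, the positive even indices Kueker's functions for C, and the odd ones
   the names of terms with (j, n) decoded by [unpickle]. *)
pose op i (e : seq V) := match i with
  | 0 => full_tree k l
  | i'.+1 => if odd i' then g e i'./2 else
       if unpickle i'./2 is Some (j, n) then term_name G e j n else vempty
  end.
have [E cE EP] := trace_club lH (club_closed_under (Hset theta) op).
have [z [[cz [y [Sy yz yo]]] Ez]] := Sst E cE.
have [M [[cM Mcl] zM Mz]] := EP z Ez.
have [MH cM' iM] := (ctbl_subsetsP _ _).1 cM.
have Mg i e : lsub e M -> M (g e i).
  move=> eM; have := Mcl (i.*2.+1).+1 e eM; rewrite /= odd_double /= uphalf_double.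
  by apply; apply: gH; exact: lsub_sub eM.
have CM : C M by apply: gP => //; [exact: infinite_setN0|move=> e i; exact: Mg].
have fP : P (full_tree k l) by apply/(NmP pos2); exists [::]; exact: full_tree_cond.
have Mf : M (full_tree k l).
  by apply: (Mcl 0%N [::]) => //=; apply: UH; left; right.
have [_ /(_ _ Mf fP)[q [Pq qf qM]]] := CP M CM.
have [tq cq] := (NmP pos2 _).1 Pq.
have cy := Sl Sy; have [yl cy' _] := (ctbl_subsetsP _ _).1 cy.
have [b bE] := ctbl_subsets_range cy.
(* The successors of the trunk of q form a positive set, so the countable set y cannot escape all of
   them. *)
have [x xq yx] : exists2 x, code (x :: tq) ∈ q & y `<=` elts x.
  apply: contrapT => h; have [APk] := cond_pos cq (cond_trunk cq) (sfx_refl _).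
  apply; split=> //; exists (vset y); first exact: countable_Pk.
  by move=> a aq; rewrite (vset_subE yl) => ya; apply: h; exists a.
have Px : Pk k l x by have [] := cond_code cq xq.
have [|| n [j [vo vb]]] := GP x Px b; rewrite -?bE //.
apply: vb; rewrite -bE; set v := G x _ j in vo *.
have Mb : lsub (prefix b n) M by apply: lsub_prefix; rewrite -bE => w /yz/zM.
(* Counting from 0, x is entry number [size tq], so the name denotes the value v of [G x]. *)
have Mt : M (term_name G (prefix b n) j (size tq)).
  have := Mcl ((pickle (j, size tq)).*2).+1 (prefix b n) Mb.
  rewrite /= odd_double doubleK pickleK; apply; apply: UH; left; left => c.
  by rewrite term_nameE; exact: term_name_pairs.
have cr := cond_restrict cq xq (sfx_cons _ _).
have vE : term_value G (prefix b n) j (size tq) (x :: tq) = v.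
  rewrite /term_value rev_cons nth_rcons size_rev ltnn eqxx -/v; by case: pselect.
have Pr : P (restrict q (x :: tq)) by apply/(NmP pos2); exists (x :: tq); exact: cr.
have rv : feq (restrict q (x :: tq)) (term_name G (prefix b n) j (size tq)) (chk v).
  by rewrite -vE; apply: forces_term => /=.
have Mv : M v.
  apply: (forces_same_omega1E sP _ _ cM' qM Pr _ Mt _ vo rv).
  - by move=> p u.
  - by move=> p u w pu; exact: subset_trans pu.
  - exact: restrict_sub.
  - exact: name_term.
(* v is an element of [l] in M, hence in z, and z has the same countable ordinals as y. *)
have zv : z v by apply: Mz; split=> //; apply/kl; case: rk => -[[tk _] _] _ _; exact: tk vo.
by have : (z `&` elts omega1) v by []; rewrite -yo => -[].
Qed.

End Reflection.

Theorem theorem6p8 (kappa lambda : V)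
  (regk : regular kappa) (regl : regular lambda)
  (k_ge : omega2 ⊆ kappa) (kl : kappa ⊆ lambda)
  (k_cl : forall alpha, alpha ∈ kappa -> cexp alpha omega ∈ kappa) :
  [/\ SSR (cexp (num 2) (cexp_lt lambda kappa)) kappa ->
        forall I, ideal kappa lambda I -> fine kappa lambda I ->
          Nm_semiproper kappa lambda I,
      (forall I, ideal kappa lambda I -> fine kappa lambda I ->
          Nm_semiproper kappa lambda I) ->
        Nm_semiproper kappa lambda (Jbd kappa lambda)
    & Nm_semiproper kappa lambda (Jbd kappa lambda) -> SSR lambda kappa].
Proof.
have o1k : omega1 ∈ kappa := k_ge _ omega1_in_omega2.
split.
- by move=> ssr I; exact: semiproper_of_SSR.
- by move=> sem; apply: sem; [exact: Jbd_ideal|exact: Jbd_fine].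
- by move=> sem S sS; apply: reflect_of_semiproper => //; case: sS.
Qed.
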